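(* Let $K_{\aleph_0}^{(3)}$ be the complete $3$-uniform hypergraph on a countably infinite vertex set and let $G=\hat{K}_{2,4}^{(3)}$. Then the Strong Ramsey game $\mathcal{R}(K_{\aleph_0}^{(3)}, G)$ is a draw; that is, the second player $P_2$ has a strategy guaranteeing that the first player $P_1$ never claims all edges of a copy of $G$.
   Context: Strong Ramsey game $\mathcal{R}(B,G)$: $B$ (the board, possibly infinite) and $G$ (the target, finite) are $k$-uniform hypergraphs. Players $P_1$ and $P_2$ alternately claim (color) a previously unclaimed edge of $B$, with $P_1$ moving first. The first player to have claimed all edges of a copy of $G$ in $B$ wins; if neither player does so after finitely many moves, the game is a draw. (By strategy stealing $P_2$ cannot have a winning strategy, so ''the game is a draw'' means $P_2$ has a drawing strategy.) For $l\ge 3$, $\hat{K}_{2,l}$ is the graph obtained from the complete bipartite graph $K_{2,l}$ by adding the edge joining its two vertices of degree $l$. For a graph $H$ and $k\ge 2$, $H^{(k)}$ is the $k$-uniform hypergraph obtained by adding a fixed set $C$ of $k-2$ new vertices to every edge of $H$, i.e. $V(H^{(k)})=V(H)\cup C$ and $E(H^{(k)})=\{e\cup C: e\in E(H)\}$; the vertices of $C$ are called centers. Thus $\hat K_{2,4}^{(3)}$ has one center and $9$ edges. *)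

(* Defs.v *)
From mathcomp Require Import all_boot finmap.
Set Implicit Arguments. Unset Strict Implicit. Unset Printing Implicit Defensive.
Local Open Scope fset_scope.

Definition board_edge (e : {fset nat}) : bool := #|` e| == 3.

(* hat K_{2,l}: vertices 0 .. l+1; the two vertices of degree l in K_{2,l}
   are 0 and 1, the other side is 2 .. l+1; the extra edge is {0,1}. *)
Definition hatK2l_edges (l : nat) : seq (nat * nat) :=
  (0, 1) :: [seq (0, i) | i <- iota 2 l] ++ [seq (1, i) | i <- iota 2 l].

(* H^{(3)} for H = hat K_{2,l}: add the single center l+2 to every edge.
   Vertex set 0 .. l+2, edges {u, v, l+2}. *)
Definition hatK2l3_nverts (l : nat) : nat := l + 3.
Definition hatK2l3_center (l : nat) : nat := l + 2.

Definition has_copy_hatK2l3 (l : nat) (S : {fset nat} -> Prop) : Prop :=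
  exists f : nat -> nat,
    {in iota 0 (hatK2l3_nverts l) &, injective f} /\
    (forall uv, uv \in hatK2l_edges l ->
       S [fset f uv.1; f uv.2; f (hatK2l3_center l)]).

(* A play is an infinite sequence of moves p 0, p 1, p 2, ...;
   P1 makes the moves with even index, P2 those with odd index.
   A strategy of P2 maps the history (list of previous moves) to a move. *)
Definition history (p : nat -> {fset nat}) (n : nat) : seq {fset nat} :=
  map p (iota 0 n).

Definition legal_P2_strategy (s2 : seq {fset nat} -> {fset nat}) : Prop :=
  forall h : seq {fset nat},
    uniq h -> all board_edge h -> odd (size h) ->
    board_edge (s2 h) /\ s2 h \notin h.

Definition play_following (s2 : seq {fset nat} -> {fset nat})
    (p : nat -> {fset nat}) : Prop :=
  (forall i, board_edge (p i)) /\ injective p /\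
  (forall i, odd i -> p i = s2 (history p i)).

Definition claimed (parity : bool) (p : nat -> {fset nat}) (n : nat)
    (e : {fset nat}) : Prop :=
  exists i, i < n /\ odd i = parity /\ p i = e.

(* P1 wins the strong game R(K_aleph0^(3), hat K_{2,l}^(3)) in play p:
   at some moment P1 owns a copy of G while P2 owns none (by monotonicity
   this means P1 completed a copy first, so the game ended with P1's win). *)
Definition P1_wins (l : nat) (p : nat -> {fset nat}) : Prop :=
  exists n, has_copy_hatK2l3 l (claimed false p n) /\
            ~ has_copy_hatK2l3 l (claimed true p n).

(* Main.v *)
Require Import Defs.
From mathcomp Require Import all_boot finmap zify.
From Stdlib Require Import Classical ClassicalEpsilon.
Set Implicit Arguments. Unset Strict Implicit. Unset Printing Implicit Defensive.

(* A copy of the target is a "book": a center z, two spine vertices a and b, and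
   four pages i, with edges zab, zai, zbi.  Once P2 owns a three-page book c, g, g'
   and P1 has no one-move win, P2 draws forever: she plays c g' j with j fresh, P1
   must answer c g j, and these answers only give P1 edges through vertices of
   degree one.

   To get there, P2 first claims four edges c d l sharing a pair {c, d} that P1's
   first edge avoids, then three edges c x s inside the set of the four leaves l.
   P1 can only interfere with blocks c l l'.  Every block costs P2 at most one extra
   move, and a block is useless in a book whose center lies in P1's first edge,
   while books centered elsewhere waste that first edge; P2 chooses which end of the
   pair plays the role of c so that P1 never gains a tempo.  The one way for P1 to
   threaten first is a book with center z outside P2's vertices.  Then each threat
   of P1 is unique, P2's answers keep it so, and the first move of P1 that is not a
   threat lets P2 start her perpetual threats. *)

(** * Triples and books *)

Definition tri (a b c : nat) : {fset nat} := [fset a; b; c]%fset.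

Lemma in_tri x a b c : (x \in tri a b c) = [|| x == a, x == b | x == c].
Proof. by rewrite !inE -orbA. Qed.

Lemma triC a b c : tri a b c = tri b a c.
Proof. by apply/fsetP=> t; rewrite !in_tri; lia. Qed.

Lemma triCr a b c : tri a b c = tri a c b.
Proof. by apply/fsetP=> t; rewrite !in_tri; lia. Qed.

Lemma triE a b c : tri a b c = [fset x in [:: a; b; c]]%fset.
Proof. by apply/fsetP=> t; rewrite in_tri in_fset /= !inE. Qed.

Lemma tri_board a b c : uniq [:: a; b; c] -> board_edge (tri a b c).
Proof. by move=> U; rewrite /board_edge triE card_fseq undup_id. Qed.

Lemma board_eq_tri e a b c : board_edge e -> uniq [:: a; b; c] ->
  a \in e -> b \in e -> c \in e -> e = tri a b c.
Proof.
move=> /eqP ce U ae be ce'; apply/esym/eqP.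
rewrite eqEfcard ce (eqP (tri_board U)) leqnn andbT.
by apply/fsubsetP=> t; rewrite in_tri => /or3P [] /eqP ->.
Qed.

Lemma tri_inj z a i j : i != z -> i != a -> tri z a i = tri z a j -> i = j.
Proof.
by move=> iz ia /fsetP/(_ i); rewrite !in_tri (negPf iz) (negPf ia) eqxx => /esym/eqP.
Qed.

Lemma tri_spine_neq z a b j : a != z -> a != b -> a != j -> tri z a j != tri z b j.
Proof.
move=> az ab aj; apply/eqP => /fsetP/(_ a).
by rewrite !in_tri eqxx (negPf az) (negPf ab) (negPf aj).
Qed.

Lemma pick_outside (T : eqType) (s l : seq T) :
  uniq s -> size l < size s -> exists2 x, x \in s & x \notin l.
Proof.
move=> us lt; case: (boolP (all (mem l) s)) => [/allP sub|/allPn [x]]; last by exists x.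
by move: lt; rewrite ltnNge (uniq_leq_size us sub).
Qed.

(** The infinitude of the board enters through this lemma: it supplies every fresh vertex of the
    strategy. *)
Lemma exists_fresh (s : seq {fset nat}) (l : seq nat) :
  exists x, x \notin l /\ forall e, e \in s -> x \notin e.
Proof.
pose m := flatten [seq enum_fset e | e <- s] ++ l.
have [x _ xm] : exists2 x, x \in iota 0 (size m).+1 & x \notin m.
  by apply: pick_outside; rewrite ?iota_uniq ?size_iota.
exists x; move: xm; rewrite mem_cat negb_or => /andP [xs xl]; split=> // e es.
by apply: contra xs => xe; apply/flattenP; exists (enum_fset e); first exact: map_f.
Qed.

Definition book_edges (z a b : nat) (I : seq nat) : seq {fset nat} :=
  tri z a b :: [seq tri z a i | i <- I] ++ [seq tri z b i | i <- I].

Definition book (z a b : nat) (I : seq nat) (F : seq {fset nat}) : Prop :=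
  uniq [:: z, a, b & I] /\ {subset book_edges z a b I <= F}.

Definition copy (F : seq {fset nat}) : Prop :=
  exists z a b I, size I = 4 /\ book z a b I F.

Lemma size_book z a b I : size (book_edges z a b I) = (size I).*2.+1.
Proof. by rewrite /= size_cat !size_map addnn. Qed.

Lemma book_edgesP z a b I e : e \in book_edges z a b I ->
  [\/ e = tri z a b, exists2 i, i \in I & e = tri z a i
    | exists2 i, i \in I & e = tri z b i].
Proof.
rewrite inE mem_cat => /or3P [/eqP ->|/mapP [i iI ->]|/mapP [i iI ->]].
- by constructor 1.
- by constructor 2; exists i.
- by constructor 3; exists i.
Qed.

Lemma book_uniq z a b I : uniq [:: z, a, b & I] -> uniq (book_edges z a b I).
Proof.
rewrite /= !inE !negb_or => /and4P [/and3P [za zb zI] /andP [ab aI] bI uI].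
have nI i : i \in I -> [/\ i != z, i != a & i != b].
  by move=> iI; split; apply/eqP => E; subst i; [rewrite iI in zI|rewrite iI in aI|rewrite iI in bI].
rewrite mem_cat negb_or cat_uniq !map_inj_in_uniq ?uI ?andbT; first last.
- by move=> i j /nI [iz ia ib] _; exact: tri_inj.
- by move=> i j /nI [iz ia ib] _; exact: tri_inj.
apply/andP; split; first (apply/andP; split).
- by apply/negP => /mapP [i /nI [iz ia ib] /fsetP/(_ i)]; rewrite !in_tri; lia.
- by apply/negP => /mapP [i /nI [iz ia ib] /fsetP/(_ i)]; rewrite !in_tri; lia.
apply/hasPn => e /mapP [i /nI [iz ia ib] ->].
by apply/negP => /mapP [j /nI [jz ja jb] /fsetP/(_ a)]; rewrite !in_tri; lia.
Qed.

Lemma book_center z a b I e : e \in book_edges z a b I -> z \in e.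
Proof. by case/book_edgesP => [->|[i _ ->]|[i _ ->]]; rewrite in_tri eqxx. Qed.

Lemma book_vertex z a b I e t : e \in book_edges z a b I -> t \in e ->
  t \in [:: z, a, b & I].
Proof.
case/book_edgesP => [->|[i iI ->]|[i iI ->]]; rewrite in_tri !inE => /or3P [] /eqP ->;
by rewrite ?eqxx ?iI ?orbT.
Qed.

Lemma book_spine z a b I e : e \in book_edges z a b I -> (a \in e) || (b \in e).
Proof. by case/book_edgesP => [->|[i _ ->]|[i _ ->]]; rewrite !in_tri eqxx !orbT. Qed.

Lemma book_edgesC z a b I : book_edges z a b I =i book_edges z b a I.
Proof. by move=> e; rewrite !inE !mem_cat (triCr z a b) [X in _ || X]orbC. Qed.

Lemma bookC z a b I F : book z a b I F -> book z b a I F.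
Proof.
move=> [U S]; split; last by move=> e; rewrite book_edgesC; exact: S.
suff -> : uniq [:: z, b, a & I] = uniq [:: z, a, b & I] by [].
by apply: perm_uniq; rewrite perm_cons; apply/permPl; exact: (perm_catCA [:: b] [:: a] I).
Qed.

Lemma book_star z a b I y : y \in b :: I -> tri z a y \in book_edges z a b I.
Proof.
rewrite inE => /orP [/eqP ->|yI]; first by rewrite mem_head.
by rewrite inE mem_cat map_f ?orbT.
Qed.

Lemma book_star2 z a b I y : y \in I -> tri z b y \in book_edges z a b I.
Proof. by move=> yI; rewrite inE mem_cat (map_f (tri z b)) ?orbT. Qed.

Lemma star_uniq z a J : uniq [:: z, a & J] -> uniq [seq tri z a i | i <- J].
Proof.
rewrite /= inE negb_or => /and3P [/andP [_ zJ] aJ uJ].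
rewrite map_inj_in_uniq // => i j iJ _; apply: tri_inj; apply/eqP => E; subst i.
  by rewrite iJ in zJ.
by rewrite iJ in aJ.
Qed.

Lemma book_sub z a b I F G : {subset F <= G} -> book z a b I F -> book z a b I G.
Proof. by move=> FG [U S]; split=> // e /S /FG. Qed.

Lemma copy_sub F G : {subset F <= G} -> copy F -> copy G.
Proof. by move=> FG [z [a [b [I [s B]]]]]; exists z, a, b, I; split=> //; apply: book_sub B. Qed.

Lemma small_no_copy (F : seq {fset nat}) : size F < 9 -> ~ copy F.
Proof.
move=> lt [z [a [b [I [sI [U S]]]]]].
by have := uniq_leq_size (book_uniq U) S; rewrite size_book sI leqNgt lt.
Qed.

(** The counting tool behind all tempo arguments. A book has [2|I| + 1] distinct edges, of which
    only [e] may lie outside [F]; the others share [F] with the wasted edges [Y]. *)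
Lemma book_waste z a b I (e : {fset nat}) (F Y : seq {fset nat}) : book z a b I (e :: F) ->
  uniq Y -> {subset Y <= F} -> (forall y, y \in Y -> y \notin book_edges z a b I) ->
  (size I).*2 + (e \in F) + size Y <= size F.
Proof.
move=> [U S] uY YF Yn; set B := book_edges z a b I in S Yn *.
have uB : uniq B := book_uniq U.
case: (boolP (e \in F)) => eF.
  have -> : (size I).*2 + true + size Y = size (B ++ Y).
    by rewrite size_cat size_book; lia.
  apply: uniq_leq_size.
    rewrite cat_uniq uB uY andbT; apply/hasPn => y yY; exact: Yn.
  move=> y; rewrite mem_cat => /orP [/S|/YF] //.
  by rewrite inE => /orP [/eqP ->|].
pose D := filter (predC (pred1 e)) B.
apply: (@leq_trans (size (D ++ Y))).
  have : count (pred1 e) B + size D = (size I).*2.+1.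
    by rewrite size_filter count_predC size_book.
  have : count (pred1 e) B <= 1 by rewrite count_uniq_mem ?leq_b1.
  rewrite size_cat; set p := count _ _; set q := size D; set r := size Y; lia.
apply: uniq_leq_size.
  rewrite cat_uniq filter_uniq // uY andbT; apply/hasPn => y yY.
  by rewrite mem_filter negb_and (Yn _ yY) orbT.
move=> y; rewrite mem_cat mem_filter => /orP [/andP [/= ye /S]|/YF] //.
by rewrite inE (negPf ye).
Qed.

(** * Perpetual threats *)

(* Positions are pairs (F, P) with the second player to move: F lists the edges of
   the first player, P those of the second, latest first. *)
Definition legal (F P : seq {fset nat}) : Prop :=
  [/\ uniq F, forall e, e \in F -> board_edge e & forall e, e \in F -> e \notin P].

Definition free (F P : seq {fset nat}) (e : {fset nat}) : Prop :=
  [/\ board_edge e, e \notin F & e \notin P].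

Lemma legal_move F P e e' : legal F P -> free F P e -> free F (e :: P) e' ->
  legal (e' :: F) (e :: P).
Proof.
move=> [uF bF dF] [be eF eP] [be' e'F e'P]; split=> /=.
- by rewrite e'F.
- by move=> x; rewrite inE => /orP [/eqP ->|/bF].
- move=> x; rewrite inE => /orP [/eqP -> //|xF]; rewrite inE negb_or dF // andbT.
  by apply: contra eF => /eqP <-.
Qed.

(** Since [copy F] gives [copy (e :: F)] for any [e], this also excludes a finished copy in [F]. *)
Definition no_threat (F P : seq {fset nat}) : Prop :=
  forall e, e \notin P -> ~ copy (e :: F).

(** In a book with center and spine vertex [c], [g] in either order, a forced answer [c g j] is half
    of a new page; hence P1 must not own three pages of such a book. *)
Definition no_book3 (c g : nat) (F : seq {fset nat}) : Prop :=
  forall z a b K, size K = 3 -> (z = c /\ a = g) \/ (z = g /\ a = c) ->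
  ~ book z a b K F.

(** [F0] is what P1 owned when the perpetual threats began. Since then he has gained only answers
    [c g j], each with a private vertex [j]. *)
Definition answered (c g : nat) (F0 : seq {fset nat}) (J : seq nat)
    (F : seq {fset nat}) : Prop :=
  [/\ forall e, e \in F -> e \in F0 \/ exists2 j, j \in J & e = tri c g j,
      forall j, j \in J -> j != c /\ j != g
    & forall j e, j \in J -> e \in F -> j \in e -> e = tri c g j].

Section Answered.

Variables (c g : nat) (F0 : seq {fset nat}) (J : seq nat) (F : seq {fset nat}).
Hypothesis ans : answered c g F0 J F.
Variables (z a b : nat) (K : seq nat) (e : {fset nat}).
Hypotheses (sK : size K = 4) (bk : book z a b K (e :: F)).

(** By privacy only [c g j] and [e] can contain [j]. In a four-page book the center has degree 9, a
    spine vertex 5 and a page 2, so [j] is a page and these are its two edges. *)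
Lemma answered_page j : j \in J -> tri c g j \in book_edges z a b K ->
  tri c g j != e -> j \in K /\
  (tri z a j = tri c g j /\ tri z b j = e \/ tri z b j = tri c g j /\ tri z a j = e).
Proof.
have [_ _ priv] := ans.
move=> jJ jB jne; have [U S] := bk.
have only E : E \in book_edges z a b K -> j \in E -> E \in [:: tri c g j; e].
  move=> EB jE; have := S _ EB; rewrite !inE => /orP [->|EF]; first by rewrite orbT.
  by rewrite (priv _ _ jJ EF jE) eqxx.
have jc : j \in tri c g j by rewrite in_tri eqxx !orbT.
have star d d' L : {subset [seq tri z d i | i <- d' :: L] <= book_edges z a b K} ->
    uniq [:: z, d, d' & L] -> size L = 4 -> j != d.
  move=> sub uL sL; apply/eqP => jd.
  have [||E Es Eo] := @pick_outside _ [seq tri z d i | i <- d' :: L] [:: tri c g j; e].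
  - exact: star_uniq.
  - by rewrite size_map /= sL.
  move: (Es) => /mapP [i _ Ei]; move: Eo; rewrite only ?sub //.
  by rewrite Ei jd in_tri eqxx orbT.
have jz : j != z.
  apply/eqP => jz.
  have [|E Es] := @pick_outside _ _ [:: tri c g j; e] (book_uniq U).
    by rewrite size_book sK.
  by rewrite only ?jz ?(book_center Es).
have ja : j != a.
  apply: (star a b K) => // E /mapP [i iI ->]; exact: book_star.
have jb : j != b.
  have [U' _] := bookC bk.
  apply: (star b a K) => // E /mapP [i iI ->]; rewrite book_edgesC; exact: book_star.
have jK : j \in K.
  by have := book_vertex jB jc; rewrite !inE (negPf jz) (negPf ja) (negPf jb).
split=> //.
have B1 : tri z a j \in book_edges z a b K by apply: book_star; rewrite inE jK orbT.
have B2 : tri z b j \in book_edges z a b K by apply: book_star2.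
have N : tri z a j <> tri z b j.
  apply/eqP/tri_spine_neq; rewrite 1?eq_sym //; move: U.
    by rewrite /= inE negb_or => /andP [/andP []].
  by rewrite /= => /and3P [_]; rewrite inE negb_or eq_sym => /andP [].
have := only _ B1; have := only _ B2; rewrite !in_tri eqxx !orbT => /(_ isT) o2 /(_ isT).
move: o2; rewrite !inE => /orP [] /eqP o2 /orP [] /eqP o1.
- by case: N; rewrite o1 o2.
- by right.
- by left.
- by case: N; rewrite o1 o2.
Qed.

(** Deleting page [j] leaves a three-page book of the kind [no_book3] excludes. It lies in [F0]: its
    edges avoid [j], hence differ from [e], and another answer [c g j'] among them would by
    [answered_page] put the page [j'] into [e = z b j], forcing [j' = j]. *)
Lemma answered_book3 j : j \in J -> j \in K -> tri z a j = tri c g j ->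
  tri z b j = e -> no_book3 c g F0 -> False.
Proof.
have [spl ncg priv] := ans; have [U S] := bk.
move=> jJ jK E1 E2 /(_ z a b (rem j K)); have [jc jg] := ncg _ jJ.
have [jz ja jb]: [/\ j != z, j != a & j != b].
  split; apply/eqP => E; subst j; move: U; rewrite /= !inE jK ?orbT //=.
    by rewrite andbF.
  by rewrite !andbF.
have uK : uniq K by move: U; rewrite /= => /and4P [].
have za : z != a by move: U; rewrite /= !inE negb_or; case: (z == a).
apply; first by rewrite size_rem // sK.
  move/fsetP: E1 => E1; have := E1 z; have := E1 a; rewrite !in_tri !eqxx ?orbT.
  move: za jz ja; lia.
split.
  move: U; rewrite /= !inE !negb_or rem_uniq // !andbT.
  case/and4P => /and3P [-> -> zK] /andP [-> aK] bK _ /=.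
  by rewrite !(contra (@mem_rem _ _ _ _)).
move=> E EB.
have jE : j \notin E.
  apply/negP => jE; have := book_vertex EB jE.
  by rewrite !inE (negPf jz) (negPf ja) (negPf jb) mem_rem_uniq // !inE eqxx.
have EB' : E \in book_edges z a b K.
  case/book_edgesP: EB => [->|[i /mem_rem iK ->]|[i /mem_rem iK ->]].
  - exact: mem_head.
  - by apply: book_star; rewrite inE iK orbT.
  - exact: book_star2.
have Ee : E != e by apply: contra jE => /eqP ->; rewrite -E2 in_tri eqxx !orbT.
have := S _ EB'; rewrite inE (negPf Ee) /= => /spl [] // [j' j'J Ej'].
have [||j'K] := answered_page j'J; rewrite -?Ej' //.
have j'z : j' != z by apply: contraTneq j'K => ->; move: U; rewrite /= !inE !negb_or; case: (z \in K); rewrite ?andbF.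
have j'b : j' != b by apply: contraTneq j'K => ->; move: U => /= /and4P [].
have j'e : j' \in e -> j' = j.
  by rewrite -E2 in_tri (negPf j'z) (negPf j'b) => /eqP.
move=> h; have j'j : j' = j.
  by apply: j'e; case: h => [] [_ <-]; rewrite in_tri eqxx !orbT.
by move: jE; rewrite Ej' j'j in_tri eqxx !orbT.
Qed.

End Answered.

(** Either the copy uses an answer distinct from [e], which [answered_book3] refutes, or all its
    edges lie in [e :: F0]. *)
Lemma answered_no_threat c g F0 J F P : answered c g F0 J F ->
  no_threat F0 P -> no_book3 c g F0 -> no_threat F P.
Proof.
move=> ans nt nb e eP [z [a [b [K [sK bk]]]]].
case: (classic (exists j, [/\ j \in J, tri c g j \in book_edges z a b K & tri c g j != e])).
  move=> [j [jJ jB je]]; have [jK [[E1 E2]|[E1 E2]]] := answered_page ans sK bk jJ jB je.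
    exact: (answered_book3 ans sK bk jJ jK E1 E2).
  exact: (answered_book3 ans sK (bookC bk) jJ jK E1 E2).
move=> N; apply: (nt e eP); exists z, a, b, K; split=> //.
have [spl _ _] := ans; have [U S] := bk; split=> // E EB.
have [Ee|Ee] := eqVneq E e; first by rewrite Ee mem_head.
have := S _ EB; rewrite !inE (negPf Ee) /= => /spl [] // [j jJ Ej].
by case: N; exists j; rewrite -Ej.
Qed.

(** * Answering threats of the first player *)

(* The invariant while P2 answers threats with center z and spine a, b: in
   [cont_page], either the spine edge is lost for P1, or outside the three pages T
   every started page has been closed by P2. *)
Record contained (z a b d : nat) (F P : seq {fset nat}) : Prop := Contained {
  cont_uniq : uniq [:: z; a; b];
  cont_spine : forall e, e \in F -> z \in e -> (a \in e) || (b \in e);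
  cont_page : tri z a b \in P \/ exists2 T : seq nat, size T = 3 &
    forall j, j \notin [:: z; a; b] -> j \notin T ->
    (tri z a j \in F -> tri z b j \in P) /\ (tri z b j \in F -> tri z a j \in P);
  cont_linear : forall e e' p q, e \in F -> e' \in F -> z \notin e -> z \notin e' ->
    p != q -> p \in e -> p \in e' -> q \in e -> q \in e' -> e = e';
  cont_avoid : forall e, e \in F -> z \notin e -> d \notin e }.

Section Contained.

Variables (z a b d : nat) (F P : seq {fset nat}).
Hypotheses (cont : contained z a b d F P) (dis : forall e, e \in F -> e \notin P).
Variables (X e : {fset nat}).
Hypotheses (XP : X \notin P) (eP : e \notin P).

(** [X] stands for the last move of P1. Were [y] not [z], some spine vertex [p] would differ from
    [z] too. Of the five edges through [y] and [p] at most one contains [z], and at least two of the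
    other four are neither [e] nor [X]; these share [y] and [p], against [cont_linear]. *)
Lemma contained_center y p q I : size I = 4 -> book y p q I [:: e, X & F] -> y = z.
Proof.
move=> sI bk; apply/eqP; apply/negPn/negP => yz.
wlog pz : p q bk / p != z.
  move=> h; have [pz|] := eqVneq p z; last exact: h bk.
  apply: h (bookC bk) _; apply/eqP => qz; have [U _] := bk.
  by move: U; rewrite pz qz /= !inE eqxx andbF.
have [U S] := bk; have [U1 U2] : uniq [:: y, p & q :: I] /\ uniq (q :: I).
  by split=> //; move: U => /= /and3P [].
have [K [uK sK zK KI]] : exists K, [/\ uniq K, 4 <= size K, z \notin K & {subset K <= q :: I}].
  exists (filter (predC1 z) (q :: I)); split.
  - exact: filter_uniq.
  - have := count_predC (pred1 z) (q :: I); rewrite size_filter (count_uniq_mem z U2).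
    rewrite -[size (q :: I)]/(size I).+1 sI -/(predC1 z); set m := count _ _.
    by case: (z \in q :: I) => /=; lia.
  - by rewrite mem_filter /= eqxx.
  - by move=> i; rewrite mem_filter => /andP [].
pose s := [seq tri y p i | i <- K].
have us : uniq s.
  apply: star_uniq; move: U1; rewrite /= !(inE, negb_or) uK andbT.
  move=> /and3P [/and3P [-> h1 h2] /andP [h3 h4] _] /=.
  by apply/andP; split; apply: contra (KI _) _; rewrite inE negb_or ?h1 ?h3.
have ss : 4 <= size s by rewrite size_map.
have sP E : E \in s -> [/\ E \in [:: e, X & F], z \notin E, y \in E & p \in E].
  case/mapP => i iK ->; have iz : i != z by apply: contraNneq zK => <-.
  split; [|by rewrite in_tri; lia|by rewrite in_tri eqxx|by rewrite in_tri eqxx orbT].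
  exact: S _ (book_star y p (KI _ iK)).
have [|E1 Es1 En1] := @pick_outside _ s [:: e; X] us; first exact: leq_trans ss.
have [|E2 Es2 En2] := @pick_outside _ s [:: E1; e; X] us; first exact: leq_trans ss.
have [F1 z1 y1 p1] := sP _ Es1; have [F2 z2 y2 p2] := sP _ Es2.
have yp : y != p by move: U1; rewrite /= inE negb_or; case: (y == p).
move: En1 En2 F1 F2; rewrite !inE !negb_or => /andP [/negPf -> /negPf ->] /and3P [E12 /negPf -> /negPf ->] /= F1 F2.
by move/eqP: E12; apply; apply: (cont_linear cont F2 F1 z2 z1 yp).
Qed.

(** Two of the five edges [z p i] may be [e] and [X]. If [p] is neither [a] nor [b], [cont_spine]
    forces [i] to be [a] or [b] in the others, which leaves room for only two more. *)
Lemma contained_spine p q I : size I = 4 -> book z p q I [:: e, X & F] ->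
  p \in [:: a; b].
Proof.
move=> sI [U S].
pose s := [seq tri z p i | i <- q :: I].
have us : uniq s by apply: star_uniq.
have ss : size s = 5 by rewrite size_map /= sI.
apply/negPn/negP; rewrite !inE negb_or => /andP [pa pb].
have [|E Es] := @pick_outside _ s [:: e; X; tri z p a; tri z p b] us; first by rewrite ss.
case/mapP: (Es) => i iI Ei.
rewrite !inE !negb_or => /and4P [Ee EX Ea Eb].
have EF : E \in F.
  by have := S _ (book_star z p iI); rewrite -Ei !inE (negPf Ee) (negPf EX).
have := cont_spine cont EF; rewrite {1}Ei in_tri eqxx => /(_ isT).
have := cont_uniq cont; rewrite /= !inE negb_or => /and3P [/andP [za zb] _ _].
rewrite Ei !in_tri ![_ == z]eq_sym ![_ == p]eq_sym.
rewrite (negPf za) (negPf zb) (negPf pa) (negPf pb) /= => /orP [] /eqP h.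
  by rewrite Ei h eqxx in Ea.
by rewrite Ei h eqxx in Eb.
Qed.

(** With spine [a], [b], one of the four pages, [j], lies outside [T]. An edge of [F] on this page
    has its partner in [P], so both edges of the page are new: they are [X] and [e]. Thus [X]
    determines the threat. *)
Lemma contained_threat : copy [:: e, X & F] ->
  e \notin F /\ exists2 j, j \notin [:: z; a; b] &
    (X = tri z a j /\ e = tri z b j) \/ (X = tri z b j /\ e = tri z a j).
Proof.
move=> [y [p [q [I [sI bk]]]]].
have yz := contained_center sI bk; subst y.
have pab := contained_spine sI bk; have qab := contained_spine sI (bookC bk).
have {p q pab qab}bk : book z a b I [:: e, X & F].
  have [U _] := bk; have pq : p != q by move: U => /= /and3P [_]; rewrite inE negb_or => /andP [].
  move: pab qab pq; rewrite !inE => /orP [] /eqP ? /orP [] /eqP ?; subst p q; rewrite ?eqxx //.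
  by move=> _; exact: bookC.
have [U S] := bk.
have inP E : E \in book_edges z a b I -> E \notin P.
  move/S; rewrite !inE => /or3P [/eqP ->|/eqP ->|/dis] //.
have [abP|[T sT hT]] := cont_page cont.
  by case/negP: (inP _ (mem_head _ _)).
have [||j jI jT] := @pick_outside _ I T; rewrite ?sI ?sT //.
  by move: U => /= /and4P [].
have jn : j \notin [:: z; a; b].
  move: U; rewrite /= !inE !negb_or => /and4P [/and3P [_ _ h1] /andP [_ h2] h3 _].
  by apply/and3P; split; apply: contraTneq jI => ->.
have [h1 h2] := hT _ jn jT.
have B1 : tri z a j \in book_edges z a b I by apply: book_star; rewrite inE jI orbT.
have B2 : tri z b j \in book_edges z a b I by apply: book_star2.
have N : tri z a j <> tri z b j.
  move: (cont_uniq cont) (jn); rewrite /= !inE !negb_or => /and3P [/andP [za _] ab _] /and3P [_ ja _].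
  by apply/eqP/tri_spine_neq; rewrite // eq_sym.
have n1 : tri z a j \in [:: e; X].
  have := S _ B1; rewrite !inE => /or3P [->|->|/h1]; rewrite ?orbT //.
  by rewrite (negPf (inP _ B2)).
have n2 : tri z b j \in [:: e; X].
  have := S _ B2; rewrite !inE => /or3P [->|->|/h2]; rewrite ?orbT //.
  by rewrite (negPf (inP _ B1)).
move: n1 n2; rewrite !inE => /orP [] /eqP n1 /orP [] /eqP n2.
- by case: N; rewrite n1 n2.
- split; last by exists j => //; right.
  by rewrite -n1; apply/negP => /h1; apply/negP; exact: inP.
- split; last by exists j => //; left.
  by rewrite -n2; apply/negP => /h2; apply/negP; exact: inP.
- by case: N; rewrite n1 n2.
Qed.

End Contained.

Lemma contained_step z a b d (F P : seq {fset nat}) (X e : {fset nat}) :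
  contained z a b d F P -> X \notin P ->
  legal (X :: F) P -> e \notin P -> copy [:: e, X & F] ->
  e \notin X :: F /\ board_edge e /\ contained z a b d (X :: F) (e :: P).
Proof.
move=> cont XP [_ bF dF] eP cp.
have dis E : E \in F -> E \notin P by move=> EF; apply: dF; rewrite inE EF orbT.
have [eF [j jn Xe]] := contained_threat cont dis XP eP cp.
have U := cont_uniq cont.
move: (U) (jn); rewrite /= !inE !negb_or => /and3P [/andP [za zb] ab _] /and3P [jz ja jb].
have be : board_edge e.
  by case: Xe => [] [_ ->]; apply: tri_board; rewrite /= !inE !negb_or ![_ == j]eq_sym ?za ?zb ?jz ?ja ?jb.
have neX : e != X.
  by case: Xe => [] [-> ->]; apply/eqP => /fsetP/(_ a); rewrite !in_tri eqxx; lia.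
have [Xz Xab] : z \in X /\ (a \in X) || (b \in X).
  by case: Xe => [] [-> _]; rewrite !in_tri !eqxx !orbT.
rewrite neX eF; split=> //; split=> //; split=> //.
- by move=> E; rewrite inE => /orP [/eqP ->|/(cont_spine cont)].
- have [abP|[T sT hT]] := cont_page cont; first by left; rewrite inE abP orbT.
  right; exists T => // i ni iT; have [h1 h2] := hT _ ni iT.
  move: ni; rewrite !inE !negb_or => /and3P [iz ia ib].
  split=> /orP [/eqP EX|h]; first 1 last.
  + by rewrite (h1 h) orbT.
  + case: Xe => [] [EX' ->]; move: EX; rewrite EX'.
      move=> /fsetP/(_ b); rewrite !in_tri eqxx orbT ![b == _]eq_sym.
      by rewrite (negPf zb) (negPf ab) (negPf jb).
    by move/(tri_inj iz ib) => ->; rewrite eqxx.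
  + by rewrite (h2 h) orbT.
  + case: Xe => [] [EX' ->]; move: EX; rewrite EX'.
      by move/(tri_inj iz ia) => ->; rewrite eqxx.
    move=> /fsetP/(_ a); rewrite !in_tri eqxx orbT ![a == z]eq_sym ![a == j]eq_sym.
    by rewrite (negPf za) (negPf ab) (negPf ja).
- move=> E E' p q; rewrite !inE => /orP [/eqP ->|EF]; first by rewrite Xz.
  move=> /orP [/eqP ->|EF']; first by rewrite Xz.
  exact: (cont_linear cont).
- move=> E; rewrite inE => /orP [/eqP ->|]; first by rewrite Xz.
  exact: (cont_avoid cont).
Qed.

(** * Drawing positions and the moves that preserve them *)

Definition perpetual (F P : seq {fset nat}) : Prop :=
  exists c g g' I F0 J, [/\ size I = 3, book c g g' I P, answered c g F0 J F,
    no_threat F0 P & no_book3 c g F0].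

(** [X] is the move P1 has just made against a contained position, while P2 keeps a three-page book
    in reserve. As [z] is neither [c] nor [d], only one edge through [z] contains both. *)
Definition attacked (F P : seq {fset nat}) : Prop :=
  exists X F1 z a b c d x I, [/\ F = X :: F1, contained z a b d F1 P,
    z != c /\ z != d, size I = 3 & book c d x I P].

(** The inductive tree covers the bounded part of the game. Its last two constructors are leaves at
    which an invariant takes over for unboundedly many moves. *)
Inductive drawing (F P : seq {fset nat}) : Prop :=
| DrawWin e of ~ copy F & free F P e & copy (e :: P)
| DrawMove e of ~ copy F & free F P e &
    (forall e', free F (e :: P) e' -> drawing (e' :: F) (e :: P))
| DrawPerpetual of perpetual F P
| DrawAttacked of attacked F P.

Definition good_move (F P : seq {fset nat}) (e : {fset nat}) : Prop :=
  copy (e :: P) \/ forall e', free F (e :: P) e' -> drawing (e' :: F) (e :: P).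

Lemma copy_cons F e : copy F -> copy (e :: F).
Proof. by apply: copy_sub => x xF; rewrite inE xF orbT. Qed.

Lemma perpetual_step F P : perpetual F P ->
  ~ copy F /\ exists2 e, free F P e & good_move F P e.
Proof.
move=> [c [g [g' [I [F0 [J [sI bk ans nt nb]]]]]]].
have NT := answered_no_threat ans nt nb.
have [j [jl jF]] := exists_fresh (F ++ P) [:: c, g, g' & I].
have [U S] := bk.
have jFn E : j \in E -> E \notin F.
  by move=> jE; apply/negP => EF; have := jF E; rewrite mem_cat EF jE => /(_ isT).
have jPn E : j \in E -> E \notin P.
  by move=> jE; apply/negP => EP; have := jF E; rewrite mem_cat EP orbT jE => /(_ isT).
have jt s t : j \in tri s t j by rewrite in_tri eqxx !orbT.
move: (jl); rewrite !inE !negb_or => /and4P [jc jg jg' jI].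
have [cg cg' gg'] : [/\ c != g, c != g' & g != g'].
  by move: U; rewrite /= !inE !negb_or => /and4P [/and3P [-> -> _] /andP [-> _] _ _].
have fr s : s != c -> s != j -> board_edge (tri c s j).
  by move=> sc sj; apply: tri_board; rewrite /= !inE negb_or eq_sym sc eq_sym jc sj.
have b1 : board_edge (tri c g' j) by apply: fr; rewrite eq_sym.
have b2 : board_edge (tri c g j) by apply: fr; rewrite eq_sym.
split; first by move=> /(copy_cons (tri c g' j)); apply: NT; exact: jPn.
exists (tri c g' j); first by split; rewrite ?jFn ?jPn.
right=> e' [be' e'F]; rewrite inE negb_or => /andP [e'e e'P].
have [E|N] := eqVneq e' (tri c g j).
  apply: DrawPerpetual; exists c, g, g', I, F0, (j :: J); have [a1 a2 a3] := ans; split=> //.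
  - by apply: book_sub bk => x xP; rewrite inE xP orbT.
  - split.
    + move=> x; rewrite inE => /orP [/eqP ->|/a1 [xF|[i iJ ->]]].
      * by right; exists j => //; rewrite mem_head.
      * by left.
      * by right; exists i => //; rewrite inE iJ orbT.
    + by move=> i; rewrite inE => /orP [/eqP -> //|/a2].
    + move=> i x; rewrite inE => /orP [/eqP ->|iJ]; rewrite inE => /orP [/eqP ->|xF] ix.
      * exact: E.
      * by have := jFn _ ix; rewrite xF.
      * have [ic ig] := a2 _ iJ; move: ix.
        by rewrite E in_tri (negPf ic) (negPf ig) => /eqP ->.
      * exact: a3 ix.
  - by move=> e; rewrite inE negb_or => /andP [_]; exact: nt.
(* P1 left [c g j] open: with it [j] becomes the fourth page of P2. *)
apply: (@DrawWin _ _ (tri c g j)).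
- exact: NT.
- split=> //; first by rewrite inE negb_or eq_sym N jFn.
  by rewrite inE negb_or jPn // andbT; apply: tri_spine_neq; rewrite // eq_sym.
exists c, g, g', (j :: I); split; first by rewrite /= sI.
split.
  have : uniq (j :: [:: c, g, g' & I]) by rewrite cons_uniq jl U.
  by rewrite -(perm_uniq (permEl (perm_catCA [:: c; g; g'] [:: j] I))).
move=> x; have old y : y \in book_edges c g g' I -> y \in [:: tri c g j, tri c g' j & P].
  by move/S => yP; rewrite !inE yP !orbT.
case/book_edgesP => [->|[i]|[i]]; first by apply: old; rewrite mem_head.
- rewrite inE => /orP [/eqP -> ->|iI ->]; first exact: mem_head.
  by apply: old; apply: book_star; rewrite inE iI orbT.
- rewrite inE => /orP [/eqP -> ->|iI ->]; first by rewrite !inE eqxx orbT.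
  by apply: old; apply: book_star2.
Qed.

Lemma attacked_step F P : legal F P -> attacked F P ->
  ~ copy F /\ exists2 e, free F P e & good_move F P e.
Proof.
move=> leg [X [F1 [z [a [b [c [d [x [I [EF cont [zc zd] sI bk]]]]]]]]]]; subst F.
have [uF bF dF] := leg; have XP : X \notin P by apply: dF; rewrite mem_head.
have dis E : E \in F1 -> E \notin P by move=> h; apply: dF; rewrite inE h orbT.
have nc : ~ copy (X :: F1).
  move=> /(copy_cons X)/(contained_threat cont dis XP XP) [_ [j jn h]].
  move: (cont_uniq cont) jn; rewrite /= !inE !negb_or => /and3P [/andP [za _] ab _] /and3P [_ ja _].
  have /eqP : tri z a j != tri z b j by apply: tri_spine_neq; rewrite // eq_sym.
  by case: h => [] [<- <-].
case: (classic (exists2 e, e \notin P & copy (e :: X :: F1))) => [[e eP ce]|N].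
  have [eF [be cont']] := contained_step cont XP leg eP ce.
  split=> //; exists e => //; right=> e' _; apply: DrawAttacked.
  exists e', (X :: F1), z, a, b, c, d, x, I; split=> //.
  by apply: book_sub bk => y yP; rewrite inE yP orbT.
apply: perpetual_step; exists c, d, x, I, (X :: F1), [::]; split=> //.
- by split=> // e eF; left.
- by move=> e eP ce; apply: N; exists e.
(* Here [y], [p] are [c], [d] in some order. Of the four edges [y p i] one may be [X] and one may
   contain [z]; another lies in [F1], avoids [z] and contains [d], against [cont_avoid]. *)
move=> y p q K sK yp [U S].
have [||E Es En] := @pick_outside _ [seq tri y p i | i <- q :: K] [:: X; tri y p z].
- exact: star_uniq.
- by rewrite size_map /= sK.
case/mapP: Es En => i iK ->; rewrite !inE negb_or => /andP [EX Ez].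
have EF : tri y p i \in F1.
  by have := S _ (book_star y p iK); rewrite inE (negPf EX).
have iz : z != i by apply: contraNneq Ez => ->.
have := cont_avoid cont EF; rewrite !in_tri (negPf iz).
by case: yp => [] [-> ->]; rewrite (negPf zc) (negPf zd) eqxx ?orbT => /(_ isT).
Qed.

Lemma drawing_step F P : legal F P -> drawing F P ->
  ~ copy F /\ exists2 e, free F P e & good_move F P e.
Proof.
move=> leg [e nc fe ce|e nc fe h|/perpetual_step|/(attacked_step leg)] //.
- by split=> //; exists e => //; left.
- by split=> //; exists e => //; right.
Qed.

(** * The second player completes a three-page book *)

(* [open_waste]: three edges of P1 that are useless in a book with center c that
   avoids d.  A book with center c using a block must avoid d, because P2 owns
   c d l for every leaf l. *)
Record opened (c d : nat) (L : seq nat) (F P : seq {fset nat}) : Prop := Opened {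
  open_uniq : uniq [:: c, d & L];
  open_start : exists E1 E2, [/\ E1 \in F, E2 \in F, E1 != E2,
    c \notin E1 /\ d \notin E1 & forall y, y \in L -> y \notin E1 /\ y \notin E2];
  open_waste : exists Y : seq {fset nat}, [/\ uniq Y, 2 < size Y, {subset Y <= F}
    & forall e, e \in Y -> c \in e -> d \in e];
  open_star : forall y, y \in L -> tri c d y \in P }.

(* k is the number of moves P2 has lost to the blocks Bl. *)
Definition blocking (c : nat) (L : seq nat) (F Bl : seq {fset nat}) (k : nat) : Prop :=
  [/\ uniq Bl, {subset Bl <= F},
      forall e, e \in Bl -> exists i j, [/\ i \in L, j \in L & e = tri c i j],
      k <= size Bl
    & k = 2 -> forall y, y \in L -> exists2 e, e \in Bl & y \notin e].

Lemma book_board z a b I e : uniq [:: z, a, b & I] -> e \in book_edges z a b I ->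
  board_edge e.
Proof.
rewrite /= !inE !negb_or => /and4P [/and3P [za zb zI] /andP [ab aI] bI uI].
case/book_edgesP => [->|[i iI ->]|[i iI ->]]; apply: tri_board; rewrite /= !inE !negb_or.
- by rewrite za zb ab.
- by rewrite za /= andbT; apply/andP; split; apply: contraTneq iI => <-.
- by rewrite zb /= andbT; apply/andP; split; apply: contraTneq iI => <-.
Qed.

Section Completed.

Variables (c d : nat) (L : seq nat) (F P Bl : seq {fset nat}) (k : nat).
Hypotheses (op : opened c d L F P) (leg : legal F P) (k2 : k <= 2).
Hypotheses (sF : size F = 8 + k) (blk : blocking c L F Bl k).

Let dcL : d != c /\ d \notin L.
Proof.
by move: (open_uniq op); rewrite /= inE negb_or eq_sym => /and3P [/andP [-> _] ->].
Qed.

Let cL : c \notin L.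
Proof. by move: (open_uniq op); rewrite /= inE negb_or => /andP [/andP []]. Qed.

Let Bl_in e y : e \in Bl -> y \in e -> y = c \/ y \in L.
Proof.
case: blk => _ _ h _ _ /h [i [j [iL jL ->]]].
by rewrite in_tri => /or3P [] /eqP ->; [left|right|right].
Qed.

Let Bl_c e : e \in Bl -> c \in e.
Proof. by case: blk => _ _ h _ _ /h [i [j [iL jL ->]]]; rewrite in_tri eqxx. Qed.

Let Bl_d e : e \in Bl -> d \notin e.
Proof.
by have [dc dL] := dcL; move=> eB; apply/negP => /(Bl_in eB) [/eqP|]; apply/negP.
Qed.

(** P1 has [8 + k] edges, so by [book_waste] a threat wastes at most [k] of them. With center [d],
    or center [c] and no block in the book, [E1] and the blocks are too many. With center [c] and a
    block, the edges of [open_waste] are. A leaf as center is missed by [E1], [E2] and, if [k = 2],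
    by a block. *)
Lemma threat_center e y p q K : e \notin P -> size K = 4 -> book y p q K (e :: F) ->
  y \notin [:: c, d & L].
Proof.
move=> eP sK bk; have [uB BF BL sB B2] := blk.
have [dc dL] := dcL; have [_ _ dis] := leg.
have [E1 [E2 [E1F E2F E12 [cE1 dE1] LE]]] := open_start op.
have waste Y : uniq Y -> {subset Y <= F} ->
    (forall E, E \in Y -> E \notin book_edges y p q K) -> k < size Y -> False.
  move=> uY YF Yn sY; have := book_waste bk uY YF Yn; rewrite sK sF.
  by move: sY; set m := size Y; clear; case: (e \in F) => /=; lia.
have E1Bl : E1 \notin Bl by apply: contra cE1 => /Bl_c.
have w1 : y \notin E1 -> (forall E, E \in Bl -> E \notin book_edges y p q K) -> False.
  move=> yE1 h; apply: (waste (E1 :: Bl)) => /=.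
  - by rewrite E1Bl.
  - by move=> E; rewrite inE => /orP [/eqP ->|/BF].
  - move=> E; rewrite inE => /orP [/eqP ->|/h] //.
    by apply: contra yE1; exact: book_center.
  - by rewrite ltnS.
apply/negP; rewrite !inE => /or3P [/eqP yc|/eqP yd|yL].
- subst y; case: (boolP (has (mem (book_edges c p q K)) Bl)); last first.
    by move=> /hasPn h; apply: w1 => // E /h.
  case/hasP => be bB /= bbook.
  suff aux p' q' : book c p' q' K (e :: F) -> p' \in be ->
      book_edges c p' q' K =i book_edges c p q K -> False.
    have /orP [pb|qb] := book_spine bbook; first exact: (aux p q).
    by apply: (aux q p) => //; [exact: bookC|exact: book_edgesC].
  move=> [U S] pb eqB.
  have pc : p' != c by move: U; rewrite /= inE negb_or eq_sym => /andP [/andP []].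
  have pL : p' \in L by case: (Bl_in bB pb) => // /eqP; rewrite (negPf pc).
  (* If [d] were in the book, so would be the edge [c p' d], which P2 owns. *)
  have dB : d \notin [:: c, p', q' & K].
    rewrite in_cons negb_or dc /= in_cons negb_or; apply/andP; split.
      by apply/eqP => dp; rewrite dp pL in dL.
    apply/negP => /(book_star c p') /S; rewrite triCr.
    have := open_star op pL; rewrite inE => dP /orP [/eqP h|/dis].
      by rewrite -h dP in eP.
    by rewrite dP.
  have [Y [uY sY YF Yw]] := open_waste op.
  apply: (waste Y) => //; last exact: leq_trans sY.
  move=> E EY; apply/negP => EB; have := Yw _ EY (book_center EB).
  by move: EB; rewrite -eqB => EB /(book_vertex EB); apply/negP.
- subst y; apply: w1 => // E /Bl_d; apply: contra; exact: book_center.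
have [yE1 yE2] := LE _ yL.
have nb E : y \notin E -> E \notin book_edges y p q K by apply: contra; exact: book_center.
case: (ltngtP k 2) => hk; last 1 first.
- have [be bB yb] := B2 hk _ yL.
  apply: (waste [:: be; E1; E2]); rewrite ?hk //=.
  + rewrite !inE negb_or E12 /= !andbT; apply/andP; split.
      by apply: contraNneq E1Bl => <-.
    have [i [j [iL jL ->]]] := BL _ bB; have [_ iE2] := LE _ iL.
    by apply: contraNneq iE2 => <-; rewrite in_tri eqxx orbT.
  + by move=> E; rewrite !inE => /or3P [] /eqP ->; rewrite ?E1F ?E2F ?BF.
  + by move=> E; rewrite !inE => /or3P [] /eqP ->; rewrite nb.
- apply: (waste [:: E1; E2]) => //=.
  + by rewrite inE E12.
  + by move=> E; rewrite !inE => /orP [] /eqP ->.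
  + by move=> E; rewrite !inE => /orP [] /eqP ->; rewrite nb.
- by move: hk; rewrite ltnNge k2.
Qed.

(** The center is neither [c] nor a leaf, so all blocks are wasted. This makes the count tight: P1
    owns nothing but book edges and exactly [k] blocks. *)
Lemma threat_outside e y p q K : e \notin P -> size K = 4 -> book y p q K (e :: F) ->
  [/\ e \notin F, size Bl = k, forall E, E \in Bl -> y \notin E
    & forall E, E \in F -> E \in book_edges y p q K \/ E \in Bl].
Proof.
move=> eP sK bk; have [uB BF BL sB B2] := blk.
have yn := threat_center eP sK bk.
have Bly E : E \in Bl -> y \notin E.
  move=> EB; apply: contra yn => /(Bl_in EB) [->|]; rewrite !inE ?eqxx // => ->.
  by rewrite !orbT.
have nb E : E \in Bl -> E \notin book_edges y p q K.
  by move/Bly; apply: contra; exact: book_center.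
have := book_waste bk uB BF nb; rewrite sK sF => h.
have [eF sBk] : e \notin F /\ size Bl = k.
  by move: h sB; set m := size Bl; clear; case: (e \in F) => /=; lia.
split=> // E EF; case: (boolP (E \in book_edges y p q K)) => [|EB]; first by left.
case: (boolP (E \in Bl)) => [|EBl]; first by right.
have := @book_waste _ _ _ _ _ _ (E :: Bl) bk; rewrite /= EBl uB sK sF sBk => h'.
have : 4.*2 + (e \in F) + k.+1 <= 8 + k; last by clear; case: (e \in F) => /=; lia.
apply: h' => // E'; rewrite inE => /orP [/eqP ->|] //; [exact: BF|exact: nb].
Qed.

Lemma completed_no_copy : ~ copy F.
Proof.
have [_ _ dis] := leg; have [E1 [_ [E1F _ _ _ _]]] := open_start op.
(* [E1] is already in [F]; as completing edge it contradicts [e \notin F]. *)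
move=> cF; have [y [p [q [K [sK bk]]]]] := copy_cons E1 cF.
by have [] := threat_outside (dis _ E1F) sK bk; rewrite E1F.
Qed.

(** Edges of [F] through [y] belong to the book, the others are blocks. Taking [e] kills the spine
    edge or closes one page, and [T] is the other three. Two blocks with two common vertices would
    share a leaf, and the clause of [blocking] for [k = 2] would yield a third block. *)
Lemma threat_contained e y p q K : e \notin P -> size K = 4 -> book y p q K (e :: F) ->
  e \in book_edges y p q K -> contained y p q d F (e :: P).
Proof.
move=> eP sK bk eB; have [eF sBl Bly FB] := threat_outside eP sK bk.
have [U _] := bk.
have FBl E : E \in F -> y \notin E -> E \in Bl.
  by move=> EF yE; case: (FB _ EF) => // /book_center; rewrite (negPf yE).
have FBo E : E \in F -> y \in E -> E \in book_edges y p q K.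
  by move=> EF yE; case: (FB _ EF) => // /Bly; rewrite yE.
have uK : uniq K by move: U => /= /and4P [].
have page p' j : p' \in [:: p; q] -> j \notin [:: y; p; q] -> tri y p' j \in F -> j \in K.
  move=> _ jn jF; have := FBo _ jF; rewrite in_tri eqxx => /(_ isT) B.
  have := book_vertex B (_ : j \in _); rewrite in_tri eqxx !orbT => /(_ isT).
  by move: jn; rewrite !inE !negb_or => /and3P [/negPf -> /negPf -> /negPf ->].
split.
- by move: U; rewrite /= !inE !negb_or => /and4P [/and3P [-> -> _] /andP [-> _] _ _].
- by move=> E EF yE; exact: (book_spine (FBo _ EF yE)).
- case/book_edgesP: eB => [->|[i iK Ei]|[i iK Ei]]; first by left; exact: mem_head.
  + right; exists (rem i K); first by rewrite size_rem // sK.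
    move=> j jn; rewrite mem_rem_uniq // !inE negb_and negbK => /orP jr; split=> jF.
      case: jr => [/eqP ji|]; first by rewrite Ei -ji jF in eF.
      by rewrite (page p) // !inE eqxx.
    case: jr => [/eqP ->|]; first by rewrite Ei eqxx.
    by rewrite (page q) // !inE eqxx orbT.
  + right; exists (rem i K); first by rewrite size_rem // sK.
    move=> j jn; rewrite mem_rem_uniq // !inE negb_and negbK => /orP jr; split=> jF.
      case: jr => [/eqP ->|]; first by rewrite Ei eqxx.
      by rewrite (page p) // !inE eqxx.
    case: jr => [/eqP ji|]; first by rewrite Ei -ji jF in eF.
    by rewrite (page q) // !inE eqxx orbT.
- have [uB BF BL sB B2] := blk.
  move=> E E' s t EF E'F yE yE' st sE sE' tE tE'.
  have EB := FBl _ EF yE; have EB' := FBl _ E'F yE'.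
  apply/eqP/negPn/negP => EE'.
  have k_eq : k = 2.
    apply/eqP; rewrite eqn_leq k2 -sBl; apply: (@uniq_leq_size _ [:: E; E']) => /=.
      by rewrite inE EE'.
    by move=> x; rewrite !inE => /orP [] /eqP ->.
  have [w wL [wE wE']] : exists2 w, w \in L & w \in E /\ w \in E'.
    have [sc|] := Bl_in EB sE; last by exists s.
    have [tc|] := Bl_in EB tE; last by exists t.
    by move: st; rewrite sc tc eqxx.
  have [be bB wb] := B2 k_eq _ wL.
  have : size [:: be; E; E'] <= size Bl.
    apply: uniq_leq_size => /=.
      rewrite !inE EE' /= negb_or !andbT.
      by apply/andP; split; apply: contraNneq wb => ->.
    by move=> x; rewrite !inE => /or3P [] /eqP ->.
  by rewrite sBl k_eq.
- by move=> E EF yE; apply: Bl_d; exact: FBl.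
Qed.

(* Otherwise P1 would have made 7 + 4 + 1 > 10 moves: a three-page book on c, d,
   four further edges through c, x, and his first edge. *)
Lemma no_two_book3 x : x \in L -> ~ no_book3 c d F -> no_book3 c x F.
Proof.
have [dc dL] := dcL; have [_ _ dis] := leg.
move=> xL N1 y' p' q' K' sK' yp' [U' S'].
apply: N1 => y p q K sK yp bk; have [U S] := bk.
have [E1 [E2 [E1F E2F E12 [cE1 dE1] LE]]] := open_start op.
pose s := [seq tri y' p' i | i <- q' :: K'].
have us : uniq s by apply: star_uniq.
have sP E : E \in s -> [/\ E \in F, c \in E & x \in E].
  case/mapP => i iK ->; split; first by apply: S'; exact: book_star.
    by case: yp' => [] [-> ->]; rewrite in_tri eqxx ?orbT.
  by case: yp' => [] [-> ->]; rewrite in_tri eqxx ?orbT.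
have xc : x != c by apply: contraTneq xL => ->; exact: cL.
have xd : x != d by apply: contraTneq xL => ->.
have nP : tri c d x \notin F by apply/negP => /dis; rewrite (open_star op xL).
have bk1 : book y p q K (E1 :: F) by apply: book_sub bk => E EF; rewrite inE EF orbT.
have uEs : uniq (E1 :: s) by rewrite cons_uniq us andbT; apply: contra cE1 => /sP [].
have sEs : size (E1 :: s) = 5 by rewrite /= size_map /= sK'.
have := @book_waste _ _ _ _ _ _ (E1 :: s) bk1 uEs; rewrite E1F sK sF sEs.
move=> h; have : 3.*2 + true + 5 <= 8 + k; last by move: k2; clear; lia.
apply: h => // E; rewrite inE => /orP [/eqP ->|/sP [EF cE xE]] //.
  by apply/negP => /book_center; case: yp => [] [-> _]; apply/negP.
apply/negP => EB; case/negP: nP.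
have xB := book_vertex EB xE.
case: yp => [] [yE pE]; rewrite yE pE in EB S xB.
  apply: S; apply: book_star.
  by move: xB; rewrite !inE (negPf xc) (negPf xd).
have dE := book_center EB.
have [_ bF _] := leg.
rewrite -(@board_eq_tri E c d x) //; first exact: bF.
by rewrite /= !inE negb_or ![_ == x]eq_sym xc xd eq_sym dc.
Qed.

(** If P1 threatens, P2 takes the edge and keeps the book [c d x] in reserve. Otherwise her
    perpetual threats start, and [no_two_book3] tells which of [d] and [x] can play the role of
    [g]. *)
Lemma completed x I : x \in L -> size I = 3 -> uniq (x :: I) -> {subset I <= L} ->
  (forall s, s \in I -> tri c x s \in P) -> drawing F P.
Proof.
move=> xL sI uI IL lk.
have [dc dL] := dcL.
have bk3 : book c d x I P.
  split.
    rewrite 2!cons_uniq uI andbT !inE !negb_or eq_sym dc /=.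
    have nL t : t \notin L -> t != x /\ t \notin I.
      by move=> tL; split; [apply: contraNneq tL => ->|apply: contra tL => /IL].
    by have [-> ->] := nL _ cL; have [-> ->] := nL _ dL.
  move=> E /book_edgesP [->|[i iI ->]|[i iI ->]].
  - exact: (open_star op).
  - by apply: (open_star op); exact: IL.
  - exact: lk.
case: (classic (exists2 e, e \notin P & copy (e :: F))) => [[e eP]|N].
  move=> [y [p [q [K [sK bk]]]]].
  have [eF _ _ _] := threat_outside eP sK bk; have [U S] := bk.
  have eB : e \in book_edges y p q K.
    apply/negPn/negP => eB; apply: completed_no_copy; exists y, p, q, K; split=> //.
    split=> // E EB; have := S _ EB; rewrite inE => /orP [/eqP Ee|//].
    by rewrite -Ee EB in eB.
  apply: (@DrawMove _ _ e); first exact: completed_no_copy.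
    by split=> //; exact: (book_board U eB).
  move=> e' _; apply: DrawAttacked; exists e', F, y, p, q, c, d, x, I.
  have := threat_center eP sK bk; rewrite !inE !negb_or => /and3P [yc yd _].
  split=> //; first exact: threat_contained eP sK bk eB.
  by apply: book_sub bk3 => E EP; rewrite inE EP orbT.
have nt : no_threat F P by move=> e eP ce; apply: N; exists e.
have ans g : answered c g F [::] F by split=> // e eF; left.
apply: DrawPerpetual; case: (classic (no_book3 c d F)) => [nb|/(no_two_book3 xL) nb].
  by exists c, d, x, I, F, [::]; split.
by exists c, x, d, I, F, [::]; split=> //; exact: bookC.
Qed.

End Completed.

(** * Completing the third edge between leaves *)

Lemma opened_sub c d L L' F F' P P' : opened c d L F P -> perm_eq L L' ->
  {subset F <= F'} -> {subset P <= P'} -> opened c d L' F' P'.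
Proof.
move=> [U [E1 [E2 [E1F E2F E12 cd LE]]] [Y [uY sY YF Yw]] st] pL FF PP; split.
- by rewrite -(@perm_uniq _ [:: c, d & L]) // !perm_cons.
- exists E1, E2; split=> //; try exact: FF.
  by move=> y; rewrite -(perm_mem pL); exact: LE.
- by exists Y; split=> // e /YF /FF.
- by move=> y; rewrite -(perm_mem pL) => /st /PP.
Qed.

Lemma opened_leaf c d L F P l : opened c d L F P -> l \notin [:: c, d & L] ->
  (forall e, e \in F -> l \notin e) -> opened c d (l :: L) F (tri c d l :: P).
Proof.
move=> [U [E1 [E2 [E1F E2F E12 cd LE]]] W st] lL lF; split=> //.
- have : uniq (l :: [:: c, d & L]) by rewrite cons_uniq lL U.
  by rewrite -(perm_uniq (permEl (perm_catCA [:: c; d] [:: l] L))).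
- exists E1, E2; split=> // y; rewrite inE => /orP [/eqP ->|/LE //].
  by split; exact: lF.
- move=> y; rewrite inE => /orP [/eqP ->|/st h]; first exact: mem_head.
  by rewrite inE h orbT.
Qed.

Lemma blocking_sub c L F F' Bl k : blocking c L F Bl k -> {subset F <= F'} ->
  blocking c L F' Bl k.
Proof. by move=> [h1 h2 h3 h4 h5] FF; split=> // e /h2 /FF. Qed.

Lemma cons_subset (T : eqType) (x : T) s : {subset s <= x :: s}.
Proof. by move=> y ys; rewrite inE ys orbT. Qed.

Lemma complete_now c d L F P Bl k x s1 s2 s3 : opened c d L F P -> legal F P ->
  k <= 2 -> size F = 7 + k -> blocking c L F Bl k ->
  uniq [:: x; s1; s2; s3] -> all (mem L) [:: x; s1; s2; s3] ->
  tri c x s1 \in P -> tri c x s2 \in P ->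
  tri c x s3 \notin F -> tri c x s3 \notin P -> drawing F P.
Proof.
move=> op leg k2 sF blk U /allP inL P1 P2 F3 P3.
have [uB BF BL sB B2] := blk.
have cL : c \notin L by move: (open_uniq op); rewrite /= inE negb_or => /andP [/andP []].
have xc y : y \in L -> c != y by apply: contraTneq => <-.
have be : board_edge (tri c x s3).
  have xL : x \in L by apply: inL; rewrite mem_head.
  have sL : s3 \in L by apply: inL; rewrite !inE eqxx !orbT.
  apply: tri_board; rewrite /= !inE negb_or (xc _ xL) (xc _ sL) /= andbT.
  by move: U; rewrite /= !inE !negb_or => /andP [/and3P [_ _ ->]].
apply: (@DrawMove _ _ (tri c x s3)) => //.
  case: (ltnP k 2) => hk.
    by apply: small_no_copy; rewrite sF; move: hk; clear; lia.
  (* For [k = 2] P1 has exactly nine edges, so a copy would use them all; but [E1] and a block are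
     disjoint, so they have no common center. *)
  have [E1 [E2 [E1F _ _ [cE1 _] LE]]] := open_start op.
  have [b bB] : exists b, b \in Bl.
    by move: (leq_trans hk sB); case: (Bl) => // b s _; exists b; rewrite mem_head.
  move=> /(copy_cons E1) [y [p [q [K [sK bk]]]]].
  suff [E EF yE] : exists2 E, E \in F & y \notin E.
    have := @book_waste _ _ _ _ _ _ [:: E] bk isT; rewrite E1F sK sF /=.
    move=> h; have : 4.*2 + true + 1 <= 7 + k; last by move: k2; clear; lia.
    apply: h => E'; rewrite inE => /eqP -> //.
    by apply: contra yE; exact: book_center.
  case: (boolP (y \in E1)) => yE1; last by exists E1.
  exists b; first exact: BF.
  have [i [j [iL jL ->]]] := BL _ bB; apply: contraTN yE1.
  rewrite in_tri => /or3P [] /eqP -> //; [by have [] := LE _ iL|by have [] := LE _ jL].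
move=> e' fe'; have leg' : legal (e' :: F) (tri c x s3 :: P).
  by apply: legal_move fe'.
have op' : opened c d L (e' :: F) (tri c x s3 :: P).
  by apply: (opened_sub op) => //; exact: cons_subset.
apply: (@completed c d L _ _ Bl k op' leg' k2 _ _ x [:: s1; s2; s3]) => //.
- by rewrite /= sF.
- by apply: (blocking_sub blk); exact: cons_subset.
- by apply: inL; rewrite mem_head.
- by move=> s sI; apply: inL; rewrite inE sI orbT.
- by move=> s; rewrite !inE => /or3P [] /eqP ->; rewrite ?P1 ?P2 ?eqxx ?orbT.
Qed.

(* Both x and y have two edges to leaves, so a fresh leaf l creates the two
   completing moves c x l and c y l. *)
Lemma complete_by_leaf c d L F P Bl x y s1 s2 t1 t2 : opened c d L F P -> legal F P ->
  size F = 8 -> blocking c L F Bl 2 -> x != y ->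
  uniq [:: x; s1; s2] -> all (mem L) [:: x; s1; s2] ->
  uniq [:: y; t1; t2] -> all (mem L) [:: y; t1; t2] ->
  tri c x s1 \in P -> tri c x s2 \in P -> tri c y t1 \in P -> tri c y t2 \in P ->
  drawing F P.
Proof.
move=> op leg sF blk xy Ux inx Uy iny Px1 Px2 Py1 Py2.
have [l [lL lFP]] := exists_fresh (F ++ P) [:: c, d & L].
have lF e : e \in F -> l \notin e by move=> eF; apply: lFP; rewrite mem_cat eF.
have lP e : e \in P -> l \notin e by move=> eF; apply: lFP; rewrite mem_cat eF orbT.
have lt s t : l \in tri s t l by rewrite in_tri eqxx !orbT.
have lFn e : l \in e -> e \notin F by move=> le; apply/negP => /lF; rewrite le.
have lPn e : l \in e -> e \notin P by move=> le; apply/negP => /lP; rewrite le.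
have op1 := opened_leaf op lL lF.
have Uop := open_uniq op1.
have [cd cl dl] : [/\ c != d, c != l & d != l].
  by move: Uop; rewrite /= !inE !negb_or => /and3P [/and3P [-> -> _] /andP [-> _] _].
have be : board_edge (tri c d l) by apply: tri_board; rewrite /= !inE negb_or cd cl dl.
have inL y' : y' \in L -> [/\ y' != c, y' != d & y' != l].
  move=> yL; move: Uop; rewrite /= !inE !negb_or => /and4P [/and3P [_ _ h1] /andP [_ h2] h3 _].
  by split; apply: contraTneq yL => ->.
have free1 : free F P (tri c d l) by split; rewrite ?lFn ?lPn.
apply: (@DrawMove _ _ (tri c d l)) => //; first by apply: small_no_copy; rewrite sF.
move=> e' fe'; have leg' := legal_move leg free1 fe'.
have op' : opened c d (l :: L) (e' :: F) (tri c d l :: P).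
  by apply: (opened_sub op1) => //; exact: cons_subset.
have blk' : blocking c (l :: L) (e' :: F) Bl 2.
  have [h1 h2 h3 h4 h5] := blk; split=> //.
  - by move=> e /h2; exact: cons_subset.
  - by move=> e /h3 [i [j [iL jL ->]]]; exists i, j; rewrite !inE iL jL !orbT.
  (* The fresh leaf [l] lies in no block, so any block serves. *)
  - move=> _ w; rewrite inE => /orP [/eqP ->|wL]; last exact: h5.
    move: h4 h2; case: (Bl) => // b s _ h2; exists b; first exact: mem_head.
    by apply: lF; apply: h2; exact: mem_head.
suff fin w r1 r2 : uniq [:: w; r1; r2] -> all (mem L) [:: w; r1; r2] ->
    tri c w r1 \in P -> tri c w r2 \in P -> e' != tri c w l -> 
    drawing (e' :: F) (tri c d l :: P).
  have [ex|] := eqVneq e' (tri c x l); last exact: fin Ux inx Px1 Px2.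
  apply: (fin _ _ _ Uy iny Py1 Py2); rewrite ex.
  move/allP: inx => /(_ x (mem_head _ _)) /inL [xc _ xl].
  exact: tri_spine_neq.
move=> Uw inw P1 P2 ew; move/allP: (inw) => inw'.
have [wc wd wl] := inL _ (inw' w (mem_head _ _)).
have [_ _ r1l] : [/\ r1 != c, r1 != d & r1 != l] by apply: inL; apply: inw'; rewrite !inE eqxx orbT.
have [_ _ r2l] : [/\ r2 != c, r2 != d & r2 != l] by apply: inL; apply: inw'; rewrite !inE eqxx !orbT.
apply: (@complete_now c d (l :: L) _ _ Bl 2 w r1 r2 l op' leg') => //.
- by rewrite /= sF.
- by move: Uw; rewrite /= !inE !negb_or => /andP [/andP [-> ->] /andP [-> _]]; rewrite wl r1l r2l.
- by move: inw; rewrite /= !inE eqxx /= => /and4P [-> -> -> _]; rewrite !orbT.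
- exact: cons_subset.
- exact: cons_subset.
- by rewrite inE negb_or eq_sym ew lFn.
- by rewrite inE negb_or lPn // andbT; apply: tri_spine_neq.
Qed.

Lemma blocking1 c L F i j : i \in L -> j \in L -> tri c i j \in F ->
  blocking c L F [:: tri c i j] 1.
Proof.
move=> iL jL h; split=> // e; rewrite inE => /eqP -> //.
by exists i, j.
Qed.

(** The two blocks use disjoint pairs of leaves, so each leaf is missed by one of them, as
    [blocking] demands for [k = 2]. *)
Lemma blocking2 c L F i j i' j' : c \notin L -> uniq [:: i; j; i'; j'] ->
  all (mem L) [:: i; j; i'; j'] -> tri c i j \in F -> tri c i' j' \in F ->
  blocking c L F [:: tri c i j; tri c i' j'] 2.
Proof.
move=> cL U /allP inL h h'.
have dj y : y \in L -> y \in tri c i j -> y \notin tri c i' j'.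
  move=> yL; rewrite !in_tri; have /negPf -> /= : y != c by apply: contraTneq yL => ->.
  move: U; rewrite /= !inE !negb_or => /and4P [/and3P [_ h1 h2] /andP [h3 h4] _ _].
  by move=> /orP [] /eqP ->; rewrite ?h1 ?h2 ?h3 ?h4.
have iL : i \in L by apply: inL; rewrite mem_head.
split=> //.
- rewrite /= inE andbT; apply: contraTneq (dj i iL _) => [<-|]; by rewrite in_tri eqxx orbT.
- by move=> e; rewrite !inE => /orP [] /eqP ->.
- move=> e; rewrite !inE => /orP [] /eqP ->; [exists i, j|exists i', j'];
    by split=> //; apply: inL; rewrite !inE eqxx ?orbT.
- move=> _ y yL; case: (boolP (y \in tri c i j)) => yi; last by exists (tri c i j); rewrite // mem_head.
  by exists (tri c i' j'); [rewrite !inE eqxx orbT|exact: dj].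
Qed.

(** * Claiming edges between the leaves *)

(** [Q] holds the links of P2, her edges [c i j] between leaves. Her other edges contain [d], so a
    link is free as soon as it is in neither [F] nor [Q]. *)
Record linked (c d l1 l2 l3 l4 : nat) (F P Q : seq {fset nat}) (n : nat) : Prop :=
  Linked {
  link_opened : opened c d [:: l1; l2; l3; l4] F P;
  link_legal : legal F P;
  link_played : forall e, e \in P -> d \in e \/ e \in Q;
  link_mine : {subset Q <= P};
  link_size : size F = n }.

Lemma link_neq c i j i' j' : j != c -> j != i' -> j != j' -> tri c i j != tri c i' j'.
Proof.
move=> jc ji jj; apply/eqP => /fsetP/(_ j).
by rewrite !in_tri eqxx (negPf jc) (negPf ji) (negPf jj) !orbT.
Qed.

Section Linked.

Variables (c d l1 l2 l3 l4 : nat) (F P Q : seq {fset nat}) (n : nat).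
Hypothesis lk : linked c d l1 l2 l3 l4 F P Q n.

Lemma linked_free i j : i \in [:: l1; l2; l3; l4] -> j \in [:: l1; l2; l3; l4] ->
  i != j -> tri c i j \notin F -> tri c i j \notin Q -> free F P (tri c i j).
Proof.
move=> iL jL ij iF iQ.
move: (open_uniq (link_opened lk)) => /=; rewrite inE negb_or.
move=> /and3P [/andP [cd cL] dL _].
have nL y : y \in [:: l1; l2; l3; l4] -> c != y /\ d != y.
  by move=> yL; split; apply: contraTneq yL => <-.
have [ci di] := nL _ iL; have [cj dj] := nL _ jL.
split=> //; first by apply: tri_board; rewrite /= !inE negb_or ci cj ij.
apply/negP => /(link_played lk) []; last exact/negP.
by rewrite in_tri (negPf di) (negPf dj) eq_sym (negPf cd).
Qed.

Lemma linked_step i j : i \in [:: l1; l2; l3; l4] -> j \in [:: l1; l2; l3; l4] ->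
  i != j -> tri c i j \notin F -> tri c i j \notin Q -> n < 9 ->
  (forall e', linked c d l1 l2 l3 l4 (e' :: F) (tri c i j :: P) (tri c i j :: Q) n.+1 ->
     drawing (e' :: F) (tri c i j :: P)) -> drawing F P.
Proof.
move=> iL jL ij iF iQ n9 h; have fr := linked_free iL jL ij iF iQ.
apply: (@DrawMove _ _ (tri c i j)) => //.
  by apply: small_no_copy; rewrite (link_size lk).
move=> e' fe'; apply: h; split.
- by apply: (opened_sub (link_opened lk) (perm_refl _)); exact: cons_subset.
- exact: legal_move (link_legal lk) fr fe'.
- move=> e; rewrite !inE => /orP [->|/(link_played lk) []]; [by right|by left|].
  by move=> ->; right; rewrite orbT.
- move=> e; rewrite !inE => /orP [->|/(link_mine lk) ->] //.
  by rewrite orbT.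
- by rewrite /= (link_size lk).
Qed.

Lemma linked_perm m1 m2 m3 m4 : perm_eq [:: l1; l2; l3; l4] [:: m1; m2; m3; m4] ->
  linked c d m1 m2 m3 m4 F P Q n.
Proof.
move=> pm; split; [|exact: link_legal lk|exact: link_played lk|exact: link_mine lk|exact: link_size lk].
exact: (opened_sub (link_opened lk) pm).
Qed.

(** A multirule for rewriting: the fifteen disequalities among the six vertices, each in both
    orientations. *)
Lemma linked_neq : let E x y := (((x == y) = false) * ((y == x) = false))%type in
  ((E c d * E c l1 * E c l2 * E c l3 * E c l4) * (E d l1 * E d l2 * E d l3 * E d l4) *
   (E l1 l2 * E l1 l3 * E l1 l4) * (E l2 l3 * E l2 l4 * E l3 l4))%type.
Proof.
move: (open_uniq (link_opened lk)); rewrite /= !inE !negb_or.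
rewrite -!andbA; do ! case/andP=> /negPf ?; move=> _.
by do ! split => //; rewrite eq_sym.
Qed.

Lemma linked_now k Bl x s1 s2 s3 : k <= 2 -> n = 7 + k ->
  blocking c [:: l1; l2; l3; l4] F Bl k -> perm_eq [:: l1; l2; l3; l4] [:: x; s1; s2; s3] ->
  tri c x s1 \in Q -> tri c x s2 \in Q ->
  tri c x s3 \notin F -> tri c x s3 \notin Q -> drawing F P.
Proof.
move=> k2 nk blk pm P1 P2 F3 Q3.
have U : uniq [:: x; s1; s2; s3].
  by rewrite -(perm_uniq pm); move: (open_uniq (link_opened lk)) => /= /and3P [].
have inL y : y \in [:: x; s1; s2; s3] -> y \in [:: l1; l2; l3; l4] by rewrite (perm_mem pm).
apply: (@complete_now c d _ _ _ Bl k x s1 s2 s3 (link_opened lk) (link_legal lk)) => //.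
- by rewrite (link_size lk).
- exact/allP.
- exact: (link_mine lk).
- exact: (link_mine lk).
have [|||||//] := @linked_free x s3; rewrite ?inL ?inE ?eqxx ?orbT //.
by move: U; rewrite /= !inE !negb_or => /andP [/and3P []].
Qed.

(** The links of P2 contain a path [s, x, y, t] and two blocks of P1 match up the four leaves. So
    [x] and [y] have two links each, and [complete_by_leaf] applies. *)
Lemma linked_leaf x y s t i j i' j' : n = 8 ->
  perm_eq [:: l1; l2; l3; l4] [:: x; y; s; t] -> perm_eq [:: l1; l2; l3; l4] [:: i; j; i'; j'] ->
  tri c i j \in F -> tri c i' j' \in F ->
  tri c x y \in Q -> tri c x s \in Q -> tri c y t \in Q -> drawing F P.
Proof.
move=> n8 pm pm' F1 F2 Q1 Q2 Q3.
have U0 : uniq [:: l1; l2; l3; l4] by move: (open_uniq (link_opened lk)) => /= /and3P [].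
have U := U0; rewrite (perm_uniq pm) in U.
have U' := U0; rewrite (perm_uniq pm') in U'.
have cL : c \notin [:: l1; l2; l3; l4].
  by move: (open_uniq (link_opened lk)); rewrite cons_uniq inE negb_or => /andP [/andP []].
have inL w : w \in [:: x; y; s; t] -> w \in [:: l1; l2; l3; l4] by rewrite (perm_mem pm).
have mine := link_mine lk.
apply: (@complete_by_leaf c d _ _ _ [:: tri c i j; tri c i' j'] x y y s x t
  (link_opened lk) (link_legal lk)).
- by rewrite (link_size lk).
- apply: blocking2 => //; apply/allP => w; by rewrite /= (perm_mem pm').
- by move: U; rewrite /= !inE !negb_or => /andP [/and3P []].
- by move: U; rewrite /= !inE !negb_or => /and4P [/and3P [-> -> _] /andP [-> _]].
- by apply/allP => w h; apply: inL; move: h; rewrite !inE => /or3P [] ->; rewrite ?orbT.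
- by move: U; rewrite /= !inE !negb_or (eq_sym y x) => /and4P [/and3P [-> _ ->] /andP [_ ->]].
- by apply/allP => w h; apply: inL; move: h; rewrite !inE => /or3P [] ->; rewrite ?orbT.
- exact: mine.
- exact: mine.
- by rewrite triCr; exact: mine.
- exact: mine.
Qed.

End Linked.

Ltac perm4 := by apply/permP => ? /=; clear; lia.

(** P2 links [l1] to [l3], aiming at [l4]; if P1 takes [c l1 l4], she links [l2] to [l4], aiming at
    [l3]. If he takes [c l2 l3] too, his blocks are disjoint off [c] and her links form the path
    [l3, l1, l2, l4]. *)
Lemma linked_unblocked c d l1 l2 l3 l4 F P :
  linked c d l1 l2 l3 l4 F P [:: tri c l1 l2] 6 ->
  tri c l1 l3 \notin F -> tri c l1 l4 \notin F ->
  tri c l2 l3 \notin F -> tri c l2 l4 \notin F -> drawing F P.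
Proof.
move=> lk n13 n14 n23 n24; have E := linked_neq lk.
apply: (linked_step (i := l1) (j := l3) lk) => //; rewrite ?inE ?E ?eqxx ?orbT //.
  by apply: link_neq; rewrite !E.
move=> e1 lk1; have [e14|e14] := eqVneq e1 (tri c l1 l4); last first.
  apply: (@linked_now _ _ _ _ _ _ _ _ _ _ lk1 0 [::] l1 l2 l3 l4) => //.
  - by rewrite !inE eqxx orbT.
  - by rewrite mem_head.
  - by rewrite inE negb_or eq_sym e14.
  - by rewrite !inE !negb_or !link_neq ?E.
have b14 : tri c l1 l4 \in e1 :: F by rewrite e14 mem_head.
apply: (linked_step (i := l2) (j := l4) lk1) => //; rewrite ?inE ?E ?eqxx ?orbT //.
- by rewrite negb_or n24 e14 triCr (triCr c l1) link_neq ?E.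
- by rewrite !negb_or !link_neq ?E.
move=> e2 lk2; have [e23|e23] := eqVneq e2 (tri c l2 l3); last first.
  apply: (@linked_now _ _ _ _ _ _ _ _ _ _ lk2 1 [:: tri c l1 l4] l2 l1 l4 l3) => //.
  - by apply: blocking1; rewrite !inE ?eqxx ?orbT // e14 eqxx orbT.
  - perm4.
  - by rewrite !inE (triCr c l2 l1) eqxx !orbT.
  - by rewrite mem_head.
  - by rewrite !inE !negb_or eq_sym e23 n23 e14 link_neq ?E.
  - rewrite !inE !negb_or; apply/and3P; split; [by rewrite link_neq ?E| |by rewrite link_neq ?E].
    by rewrite triCr (triCr c l1) link_neq ?E.
apply: (@linked_leaf _ _ _ _ _ _ _ _ _ _ lk2 l1 l2 l3 l4 l1 l4 l2 l3) => //.
- perm4.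
- by rewrite inE b14 orbT.
- by rewrite e23 mem_head.
- by rewrite !inE eqxx !orbT.
- by rewrite !inE eqxx !orbT.
- by rewrite !inE eqxx.
Qed.

(** P2 continues at [l2], so that the forced block [c l2 l4] meets [c l1 l3] only in [c]. Linking
    [l1] to [l4] then gives the path [l3, l2, l1, l4], whatever P1 replies. *)
Lemma linked_blocked c d l1 l2 l3 l4 F P :
  linked c d l1 l2 l3 l4 F P [:: tri c l1 l2] 6 ->
  tri c l1 l3 \in F -> tri c l1 l4 \notin F ->
  tri c l2 l3 \notin F -> tri c l2 l4 \notin F -> drawing F P.
Proof.
move=> lk b13 n14 n23 n24; have E := linked_neq lk.
apply: (linked_step (i := l2) (j := l3) lk) => //; rewrite ?inE ?E ?eqxx ?orbT //.
  by apply: link_neq; rewrite !E.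
move=> e1 lk1; have [e24|e24] := eqVneq e1 (tri c l2 l4); last first.
  apply: (@linked_now _ _ _ _ _ _ _ _ _ _ lk1 0 [::] l2 l1 l3 l4) => //.
  - perm4.
  - by rewrite !inE (triCr c l2 l1) eqxx orbT.
  - by rewrite mem_head.
  - by rewrite inE negb_or eq_sym e24.
  - by rewrite !inE !negb_or !link_neq ?E.
apply: (linked_step (i := l1) (j := l4) lk1) => //; rewrite ?inE ?E ?eqxx ?orbT //.
- by rewrite negb_or n14 e24 triCr (triCr c l2) link_neq ?E.
- by rewrite !negb_or !link_neq ?E.
move=> e2 lk2.
apply: (@linked_leaf _ _ _ _ _ _ _ _ _ _ lk2 l1 l2 l4 l3 l1 l3 l2 l4) => //.
- perm4.
- perm4.
- by rewrite !inE b13 !orbT.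
- by rewrite !inE e24 eqxx !orbT.
- by rewrite !inE eqxx !orbT.
- by rewrite !inE eqxx.
- by rewrite !inE eqxx !orbT.
Qed.

Lemma linked_start c d l1 l2 l3 l4 F P : linked c d l1 l2 l3 l4 F P [::] 5 ->
  tri c l1 l2 \notin F -> tri c l1 l3 \notin F -> tri c l1 l4 \notin F ->
  tri c l2 l3 \notin F -> tri c l2 l4 \notin F -> drawing F P.
Proof.
move=> lk n12 n13 n14 n23 n24; have E := linked_neq lk.
apply: (linked_step (i := l1) (j := l2) lk) => //; rewrite ?inE ?E ?eqxx ?orbT //.
move=> e lk1.
have e_ne i j : e != tri c i j -> tri c i j \notin F -> tri c i j \notin e :: F.
  by rewrite eq_sym inE negb_or => -> ->.
have nsw i j : tri c i j \notin F -> tri c j i \notin F by rewrite triCr.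
(* The four possible blocks at [l1] or [l2] are equivalent under swapping [l1] with [l2] and [l3]
   with [l4]. *)
have [e13|e13] := eqVneq e (tri c l1 l3).
  by apply: (linked_blocked lk1); rewrite ?e13 ?mem_head // inE negb_or ?n14 ?n23 ?n24 andbT;
    [rewrite link_neq ?E|rewrite triCr (triCr c l1) link_neq ?E|rewrite link_neq ?E].
have [e14|e14] := eqVneq e (tri c l1 l4).
  have lk1' : linked c d l1 l2 l4 l3 (e :: F) (tri c l1 l2 :: P) [:: tri c l1 l2] 6.
    by apply: (linked_perm lk1); perm4.
  by apply: (linked_blocked lk1'); rewrite ?e14 ?mem_head // inE negb_or ?n13 ?n23 ?n24 andbT;
    [rewrite link_neq ?E|rewrite triCr (triCr c l1) link_neq ?E|rewrite link_neq ?E].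
have [e23|e23] := eqVneq e (tri c l2 l3).
  have lk1' : linked c d l2 l1 l3 l4 (e :: F) (tri c l1 l2 :: P) [:: tri c l2 l1] 6.
    by rewrite (triCr c l2 l1); apply: (linked_perm lk1); perm4.
  by apply: (linked_blocked lk1'); rewrite ?e23 ?mem_head // inE negb_or ?n13 ?n14 ?n24 andbT;
    [rewrite link_neq ?E|rewrite triCr (triCr c l2) link_neq ?E|rewrite link_neq ?E].
have [e24|e24] := eqVneq e (tri c l2 l4).
  have lk1' : linked c d l2 l1 l4 l3 (e :: F) (tri c l1 l2 :: P) [:: tri c l2 l1] 6.
    by rewrite (triCr c l2 l1); apply: (linked_perm lk1); perm4.
  by apply: (linked_blocked lk1'); rewrite ?e24 ?mem_head // inE negb_or ?n13 ?n14 ?n23 andbT;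
    [rewrite link_neq ?E|rewrite triCr (triCr c l2) link_neq ?E|rewrite link_neq ?E].
by apply: (linked_unblocked lk1); apply: e_ne.
Qed.

(** P1 has at most one block; relabelling the leaves makes it [c l3 l4], the one block that
    [linked_start] permits. *)
Lemma linked_drawing c d l1 l2 l3 l4 F P : linked c d l1 l2 l3 l4 F P [::] 5 ->
  (forall i j i' j', all (mem [:: l1; l2; l3; l4]) [:: i; j; i'; j'] ->
     i != j -> i' != j' -> tri c i j \in F -> tri c i' j' \in F -> tri c i j = tri c i' j') ->
  drawing F P.
Proof.
move=> lk one; have E := linked_neq lk.
have relabel m1 m2 m3 m4 : perm_eq [:: l1; l2; l3; l4] [:: m1; m2; m3; m4] ->
    tri c m3 m4 \in F -> drawing F P.
  move=> pm b34; have lk' := linked_perm lk pm; have E' := linked_neq lk'.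
  have none i j : i \in [:: m1; m2; m3; m4] -> j \in [:: m1; m2; m3; m4] -> i != j ->
      tri c i j != tri c m3 m4 -> tri c i j \notin F.
    move=> iL jL ij N; apply: contraNN N => F1; apply/eqP; apply: one => //; last by rewrite E'.
    by rewrite /= !(perm_mem pm) iL jL !inE !eqxx !orbT.
  by apply: (linked_start lk'); apply: none; rewrite ?inE ?eqxx ?orbT ?E' //;
    rewrite triCr link_neq ?E'.
case: (boolP (tri c l1 l2 \in F)) => [|n12]; first by apply: (relabel l3 l4); perm4.
case: (boolP (tri c l1 l3 \in F)) => [|n13]; first by apply: (relabel l2 l4); perm4.
case: (boolP (tri c l1 l4 \in F)) => [|n14]; first by apply: (relabel l2 l3); perm4.
case: (boolP (tri c l2 l3 \in F)) => [|n23]; first by apply: (relabel l1 l4); perm4.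
case: (boolP (tri c l2 l4 \in F)) => [|n24]; first by apply: (relabel l1 l3); perm4.
exact: (linked_start lk).
Qed.

(** * The opening *)

(** These edges may serve P1 in a book with center [c] that avoids [d]; all others qualify for
    [open_waste]. *)
Definition useful (c d : nat) : pred {fset nat} := fun e => (c \in e) && (d \notin e).

Definition block (c : nat) (L : seq nat) : pred {fset nat} :=
  fun e => (c \in e) && all (mem (c :: L)) (enum_fset e).

Lemma block_tri c L i j : i \in L -> j \in L -> block c L (tri c i j).
Proof.
move=> iL jL; rewrite /block in_tri eqxx /=; apply/allP => y /=.
rewrite -[y \in enum_fset _]/(y \in tri c i j) in_tri !inE.
by move=> /or3P [] /eqP ->; rewrite ?eqxx ?iL ?jL ?orbT.
Qed.

Lemma block_useful c d L e : d \notin c :: L -> block c L e -> useful c d e.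
Proof.
by move=> dL /andP [ce /allP h]; rewrite /useful ce /=; apply: contra dL => /h.
Qed.

Lemma count_disjoint (T : Type) (p q : pred T) (s : seq T) :
  (forall x, p x -> ~~ q x) -> count p s + count q s <= size s.
Proof.
move=> pq; elim: s => //= x s IH; have := pq x.
by case: (p x) => [/(_ isT) /negPf ->|_]; [|case: (q x)] => /=; lia.
Qed.

(** With at most two useful edges among [E2] to [E5], at least two are left to form, with [E1], the
    set [open_waste]. [E1] and [E2] avoid the leaves, so any block is among [E3], [E4], [E5]. *)
Lemma open_side c d l1 l2 l3 l4 (E1 E2 E3 E4 E5 : {fset nat}) (P : seq {fset nat}) :
  let L := [:: l1; l2; l3; l4] in let F := [:: E5; E4; E3; E2; E1] in
  uniq [:: c, d & L] -> legal F P -> c \notin E1 -> d \notin E1 ->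
  (forall y, y \in L -> y \notin E1 /\ y \notin E2) ->
  (forall y, y \in L -> tri c d y \in P) -> (forall e, e \in P -> d \in e) ->
  count (useful c d) [:: E5; E4; E3; E2] <= 2 -> count (block c L) [:: E5; E4; E3] <= 1 ->
  drawing F P.
Proof.
move=> L F U leg cE1 dE1 LE st Pd g2 b1; have [uF _ _] := leg.
have [uF4 E1n] : uniq [:: E5; E4; E3; E2] /\ E1 \notin [:: E5; E4; E3; E2].
  by move: uF; rewrite /F -[[:: E5; E4; E3; E2; E1]]/(rcons [:: E5; E4; E3; E2] E1) rcons_uniq => /andP [].
have F1 : E1 \in F by rewrite !inE eqxx !orbT.
have F2 : E2 \in F by rewrite !inE eqxx !orbT.
apply: (@linked_drawing c d l1 l2 l3 l4); first split=> //.
- split=> //.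
  + exists E1, E2; split=> //; apply: contraNneq E1n => ->; by rewrite !inE eqxx !orbT.
  + exists (E1 :: filter (predC (useful c d)) [:: E5; E4; E3; E2]); split.
    * by rewrite cons_uniq filter_uniq // andbT mem_filter negb_and E1n orbT.
    * have := count_predC (useful c d) [:: E5; E4; E3; E2].
      rewrite -[size (E1 :: _)]/((size (filter _ _)).+1) size_filter.
      rewrite -[size [:: E5; E4; E3; E2]]/4.
      by move: g2; set p := count _ _; set q := count _ _; clear; lia.
    * move=> e; rewrite inE => /orP [/eqP -> //|]; rewrite mem_filter => /andP [_].
      by rewrite /F !inE => /or4P [] ->; rewrite ?orbT.
    * move=> e; rewrite inE => /orP [/eqP ->|]; first by rewrite (negPf cE1).
      by rewrite mem_filter /= /useful negb_and negbK => /andP [/orP [/negPf ->|]].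
- by move=> e /Pd; left.
move=> i j i' j' /and5P [iL jL iL' jL' _] ij ij' F3 F4.
have late s t : s \in L -> t \in L -> tri c s t \in F ->
    tri c s t \in filter (block c L) [:: E5; E4; E3].
  move=> sL tL; rewrite mem_filter block_tri // /F !inE.
  have [s1 s2] := LE _ sL.
  have /negPf -> : tri c s t != E2.
    by apply: contraNneq s2 => <-; rewrite in_tri eqxx orbT.
  have /negPf -> : tri c s t != E1.
    by apply: contraNneq s1 => <-; rewrite in_tri eqxx orbT.
  by rewrite !orbF.
apply/eqP/negPn/negP => N.
have : size [:: tri c i j; tri c i' j'] <= count (block c L) [:: E5; E4; E3].
  rewrite -size_filter; apply: uniq_leq_size; first by rewrite /= inE N.
  by move=> e; rewrite !inE => /orP [] /eqP ->; apply: late.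
by rewrite leqNgt ltnS b1.
Qed.

(** No edge is useful for both ends, and blocks are useful. If [u] has three useful edges, [v] has
    at most one; if [u] has two blocks, [v] has at most one block and two useful edges. So one end
    meets the bounds of [open_side]. *)
Lemma open_choose u v l1 l2 l3 l4 (E1 E2 E3 E4 E5 : {fset nat}) :
  let L := [:: l1; l2; l3; l4] in let F := [:: E5; E4; E3; E2; E1] in
  let P := [:: tri u v l4; tri u v l3; tri u v l2; tri u v l1] in
  uniq [:: u, v & L] -> legal F P -> u \notin E1 -> v \notin E1 ->
  (forall y, y \in L -> y \notin E1 /\ y \notin E2) -> drawing F P.
Proof.
move=> L F P U leg uE1 vE1 LE.
have U' : uniq [:: v, u & L].
  by rewrite -(perm_uniq (permEl (perm_catCA [:: u] [:: v] L))).
have [uv vL] : u \notin v :: L /\ v \notin u :: L.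
  by move: U U'; rewrite ![uniq (_ :: _ :: _)]cons_uniq => /andP [-> _] /andP [->].
have PU y : y \in L -> tri u v y \in P.
  by rewrite !inE => /or4P [] /eqP ->; rewrite eqxx ?orbT.
have PV y : y \in L -> tri v u y \in P by rewrite triC; exact: PU.
have Pin e : e \in P -> u \in e /\ v \in e.
  by rewrite !inE => /or4P [] /eqP ->; rewrite !in_tri !eqxx ?orbT.
(* [E2] avoids the leaves, so inside [c :: L] it could contain only [c], yet it has three
   vertices. *)
have E2b c : block c L E2 = false.
  apply/negP => /andP [cE2 /allP h].
  have [_ /(_ E2)] := leg; rewrite !inE eqxx !orbT => /(_ isT) /eqP c3 _.
  have : size (enum_fset E2) <= size [:: c].
    apply: uniq_leq_size; first exact: fset_uniq.
    move=> y yE; have := h y yE; rewrite -[mem _ y]/(y \in c :: L) inE mem_seq1 => /orP [-> //|yL].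
    by have [_] := LE y yL; rewrite -[y \in E2]/(y \in enum_fset E2) yE.
  by rewrite -[size _]/#|` E2|%fset c3.
have bg c d s : d \notin c :: L -> count (block c L) s <= count (useful c d) s.
  by move=> dL; apply: sub_count => e; exact: block_useful.
have bg4 c d : d \notin c :: L ->
    count (block c L) [:: E5; E4; E3] <= count (useful c d) [:: E5; E4; E3; E2].
  by move=> /(bg c d [:: E5; E4; E3; E2]); apply: leq_trans; rewrite /= E2b !addn0.
have gg := @count_disjoint _ (useful u v) (useful v u) [:: E5; E4; E3; E2].
have bb := @count_disjoint _ (block u L) (block v L) [:: E5; E4; E3].
have side c d := @open_side c d l1 l2 l3 l4 E1 E2 E3 E4 E5 P.
have := side u v U leg uE1 vE1 LE PU (fun e h => (Pin e h).2).
have := side v u U' leg vE1 uE1 LE PV (fun e h => (Pin e h).1).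
have {gg} : count (useful u v) [:: E5; E4; E3; E2] + count (useful v u) [:: E5; E4; E3; E2] <= 4.
  by apply: gg => e /andP [ue _]; rewrite /useful ue andbF.
have {bb} : count (block u L) [:: E5; E4; E3] + count (block v L) [:: E5; E4; E3] <= 3.
  apply: bb => e /(block_useful vL) /andP [ue ve].
  by rewrite /block (negPf ve).
move: (bg4 u v vL) (bg4 v u uv).
set a := count (useful u v) _; set b := count (useful v u) _.
set a' := count (block u L) _; set b' := count (block v L) _.
move=> h1 h2 h3 h4 h5 h6.
have [/andP [q1 q2]|N] := boolP ((a <= 2) && (a' <= 1)); first exact: h6.
by apply: h5; move: h1 h2 h3 h4 N; clear; lia.
Qed.

Lemma fresh_leaf_free (F P : seq {fset nat}) (u v l : nat) : u != v -> l \notin [:: u; v] ->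
  (forall e, e \in F ++ P -> l \notin e) -> free F P (tri u v l).
Proof.
move=> uv; rewrite !inE negb_or => /andP [lu lv] lF.
have lt : l \in tri u v l by rewrite in_tri eqxx !orbT.
split.
- by apply: tri_board; rewrite /= !inE negb_or uv ![_ == l]eq_sym lu lv.
- by apply/negP => h; have := lF (tri u v l); rewrite mem_cat h lt => /(_ isT).
- by apply/negP => h; have := lF (tri u v l); rewrite mem_cat h orbT lt => /(_ isT).
Qed.

Lemma open_second u v l1 (E1 E2 : {fset nat}) :
  uniq [:: u; v; l1] -> legal [:: E2; E1] [:: tri u v l1] ->
  u \notin E1 -> v \notin E1 -> l1 \notin E1 -> l1 \notin E2 ->
  drawing [:: E2; E1] [:: tri u v l1].
Proof.
move=> U leg uE1 vE1 lE1 lE2.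
have uv : u != v by move: U; rewrite /= !inE negb_or => /andP [/andP []].
have split2 l s : l \notin [:: u, v & s] -> l \notin [:: u; v].
  by rewrite !inE !negb_or => /and3P [-> ->].
have [l2 [n2 f2]] := exists_fresh ([:: E2; E1] ++ [:: tri u v l1]) [:: u; v; l1].
have fr2 := fresh_leaf_free uv (split2 _ _ n2) f2.
apply: (DrawMove _ fr2) => [|E3 fE3]; first exact: small_no_copy.
have leg3 := legal_move leg fr2 fE3.
have [l3 [n3 f3]] :=
  exists_fresh ([:: E3; E2; E1] ++ [:: tri u v l2; tri u v l1]) [:: u; v; l2; l1].
have fr3 := fresh_leaf_free uv (split2 _ _ n3) f3.
apply: (DrawMove _ fr3) => [|E4 fE4]; first exact: small_no_copy.
have leg4 := legal_move leg3 fr3 fE4.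
have [l4 [n4 f4]] := exists_fresh ([:: E4; E3; E2; E1] ++
  [:: tri u v l3; tri u v l2; tri u v l1]) [:: u; v; l3; l2; l1].
have fr4 := fresh_leaf_free uv (split2 _ _ n4) f4.
apply: (DrawMove _ fr4) => [|E5 fE5]; first exact: small_no_copy.
have leg5 := legal_move leg4 fr4 fE5.
apply: open_choose => //.
  move: U n2 n3 n4; rewrite /= !inE !negb_or.
  move=> /and3P [/andP [? ?] ? _] /and3P [? ? ?] /and4P [? ? ? ?] /and5P [? ? ? ? ?].
  by rewrite !andbT; do ! (apply/andP; split) => //; rewrite eq_sym.
move=> y; rewrite !inE => /or4P [] /eqP ->; split=> //.
- by apply: f2; rewrite !inE eqxx ?orbT.
- by apply: f2; rewrite !inE eqxx ?orbT.
- by apply: f3; rewrite !inE eqxx ?orbT.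
- by apply: f3; rewrite !inE eqxx ?orbT.
- by apply: f4; rewrite !inE eqxx ?orbT.
- by apply: f4; rewrite !inE eqxx ?orbT.
Qed.

Lemma open_first (E1 : {fset nat}) : board_edge E1 -> drawing [:: E1] [::].
Proof.
move=> bE1.
have leg : legal [:: E1] [::] by split=> // e; rewrite inE => /eqP ->.
have [u [_ fu]] := exists_fresh [:: E1] [::].
have [v [nv fv]] := exists_fresh [:: E1] [:: u].
have [w [nw fw]] := exists_fresh [:: E1] [:: u; v].
have uv : u != v by move: nv; rewrite inE eq_sym.
have fr : free [:: E1] [::] (tri u v w).
  by apply: fresh_leaf_free => // e; rewrite cats0; exact: fw.
have E1E : E1 \in [:: E1] by rewrite mem_head.
apply: (DrawMove _ fr) => [|E2 fE2]; first exact: small_no_copy.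
have leg2 := legal_move leg fr fE2.
have U : uniq [:: u; v; w].
  by move: nw; rewrite /= !inE !negb_or uv andbT ![w == _]eq_sym.
have [uw vw] : u != w /\ v != w.
  by move: nw; rewrite !inE negb_or ![w == _]eq_sym => /andP [].
have uE1 := fu _ E1E; have vE1 := fv _ E1E; have wE1 := fw _ E1E.
(* [E2] differs from [u v w], so it misses one of the three vertices. That vertex becomes the first
   leaf and the other two form the pair. *)
case: (boolP (w \in E2)) => wE2; last exact: open_second.
case: (boolP (v \in E2)) => vE2; last first.
  move: leg2; rewrite triCr => leg2; apply: open_second => //=.
  by rewrite !inE negb_or uv uw eq_sym vw.
case: (boolP (u \in E2)) => uE2; last first.
  move: leg2; rewrite triC triCr => leg2; apply: open_second => //=.
  by rewrite !inE negb_or vw ![_ == u]eq_sym uv uw.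
have [bE2 _] := fE2; rewrite inE => /eqP []; exact: board_eq_tri.
Qed.

(** * From drawing positions to a strategy *)

Lemma copy_of_has_copy (S : {fset nat} -> Prop) (F : seq {fset nat}) :
  (forall e, S e -> e \in F) -> has_copy_hatK2l3 4 S -> copy F.
Proof.
move=> SF [f [inj h]].
(* For [l = 4] the center is the vertex [l + 2 = 6]. *)
exists (f 6), (f 0), (f 1), [:: f 2; f 3; f 4; f 5]; split=> //; split.
  rewrite -[[:: _, _, _ & _]]/(map f [:: 6; 0; 1; 2; 3; 4; 5]) map_inj_in_uniq //.
  by move=> i j iI jI; apply: inj; rewrite mem_iota /hatK2l3_nverts; move: iI jI; rewrite !inE; lia.
have {}h i j : (i, j) \in hatK2l_edges 4 -> tri (f 6) (f i) (f j) \in F.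
  by move=> /h /SF; rewrite triC triCr.
by move=> e; rewrite /= !inE; do ! case/orP; move=> /eqP ->; apply: h.
Qed.

Lemma has_copy_of_copy (S : {fset nat} -> Prop) (F : seq {fset nat}) :
  (forall e, e \in F -> S e) -> copy F -> has_copy_hatK2l3 4 S.
Proof.
move=> FS [z [a [b [I [sI [U sub]]]]]].
case: I sI U sub => [|i1 [|i2 [|i3 [|i4 [|]]]]] // _ U sub.
have U' : uniq [:: a; b; i1; i2; i3; i4; z].
  by rewrite -(@perm_uniq _ [:: z; a; b; i1; i2; i3; i4]) //; apply/permP => p /=; clear; lia.
exists (nth 0 [:: a; b; i1; i2; i3; i4; z]); split.
  move=> i j; rewrite !mem_iota => /andP [_ hi] /andP [_ hj] /eqP.
  by rewrite nth_uniq // => /eqP.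
move=> [i j] ij; apply: FS; rewrite -/(tri _ _ _) triCr triC; apply: sub.
by move: ij; rewrite /hatK2l_edges /= !inE !xpair_eqE;
  do ! case/orP; move=> /andP [/eqP -> /eqP ->]; rewrite /= ?eqxx ?orbT.
Qed.

Fixpoint alternate (T : Type) (s : seq T) : seq T :=
  if s is x :: s' then x :: (if s' is _ :: s'' then alternate s'' else [::]) else [::].

(** As [rev h] starts with the last move, this collects the moves of whoever moved last: P1 when [h]
    has odd length. *)
Definition mover (h : seq {fset nat}) : seq {fset nat} := alternate (rev h).

Section Play.

Variable p : nat -> {fset nat}.

Definition moves (n : nat) : seq {fset nat} := mover (history p n).

Lemma historyS n : history p n.+1 = rcons (history p n) (p n).
Proof. by rewrite /history -addn1 iotaD map_cat cats1. Qed.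

Lemma movesSS n : moves n.+2 = p n.+1 :: moves n.
Proof. by rewrite /moves /mover !historyS !rev_rcons. Qed.

Lemma mem_moves n e : e \in moves n -> exists i, i < n /\ odd i = ~~ odd n /\ p i = e.
Proof.
have [m] := ubnP n; elim: m n => // m IH [|[|n]] nm //.
  by rewrite inE => /eqP ->; exists 0.
rewrite movesSS inE => /orP [/eqP ->|/IH]; first by exists n.+1; rewrite /= negbK.
move=> [|i [i1 [i2 i3]]]; first by lia.
by exists i; rewrite i2 /= negbK; split=> //; lia.
Qed.

Lemma moves_mem n i : i < n -> odd i = ~~ odd n -> p i \in moves n.
Proof.
have [m] := ubnP n; elim: m n => // m IH [|[|n]] nm //.
  by rewrite ltnS leqn0 => /eqP -> _; rewrite mem_head.
move=> i1; rewrite /= negbK movesSS inE => i2.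
have [->|N] := eqVneq i n.+1; first by rewrite eqxx.
by rewrite IH ?orbT //; move: i1 i2 N; lia.
Qed.

End Play.

Lemma exists_free F P : exists e, free F P e.
Proof.
have [u [_ fu]] := exists_fresh (F ++ P) [::].
have [v [nv fv]] := exists_fresh (F ++ P) [:: u].
have [w [nw fw]] := exists_fresh (F ++ P) [:: u; v].
by exists (tri u v w); apply: fresh_leaf_free => //; move: nv; rewrite inE eq_sym.
Qed.

(** Freeness is demanded in every position, so that the strategy is legal on arbitrary histories; a
    good move is demanded only in drawing positions. *)
Definition answer_spec (F P : seq {fset nat}) (e : {fset nat}) : Prop :=
  free F P e /\ (legal F P -> drawing F P -> good_move F P e).

Lemma answer_exists F P : exists e, answer_spec F P e.
Proof.
case: (classic (legal F P /\ drawing F P)) => [[leg dr]|N].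
  by have [_ [e fe ge]] := drawing_step leg dr; exists e.
by have [e fe] := exists_free F P; exists e; split=> // leg dr; case: N.
Qed.

Definition draw_strategy (h : seq {fset nat}) : {fset nat} :=
  let F := mover h in let P := alternate (behead (rev h)) in
  epsilon (inhabits fset0) (answer_spec F P).

Lemma mem_alternate (T : eqType) (s : seq T) x :
  x \in s -> (x \in alternate s) || (x \in alternate (behead s)).
Proof.
elim: s => // y s IH; rewrite inE => /orP [/eqP ->|/IH]; first by rewrite mem_head.
rewrite orbC [alternate (y :: s)]/= inE; case: s {IH} => //= z s /orP [] ->; by rewrite ?orbT.
Qed.

Lemma draw_strategy_spec h :
  answer_spec (mover h) (alternate (behead (rev h))) (draw_strategy h).
Proof. exact: epsilon_spec (answer_exists _ _). Qed.

Lemma draw_strategy_legal : legal_P2_strategy draw_strategy.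
Proof.
move=> h _ _ _; have [[be eF eP] _] := draw_strategy_spec h; split=> //.
apply/negP => eh; have := @mem_alternate _ (rev h) (draw_strategy h).
by rewrite mem_rev eh => /(_ isT) /orP []; apply/negP.
Qed.

Section Following.

Variable p : nat -> {fset nat}.
Hypotheses (bp : forall i, board_edge (p i)) (ip : injective p).
Hypothesis fp : forall i, odd i -> p i = draw_strategy (history p i).

Lemma moves_legal k : legal (moves p k.*2.+1) (moves p k.*2).
Proof.
split.
- elim: k => // k IH; rewrite doubleS movesSS cons_uniq IH andbT.
  by apply/negP => /mem_moves [i [lt [_ /ip]]]; lia.
- by move=> e /mem_moves [i [_ [_ <-]]].
- move=> e /mem_moves [i [_ [oi Ei]]]; apply/negP => /mem_moves [j [_ [oj Ej]]].
  by move: oi; rewrite (ip (etrans Ei (esym Ej))) oj /=; case: (odd _).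
Qed.

Lemma moves_notin m n : m <= n -> p n \notin moves p m.
Proof. by move=> mn; apply/negP => /mem_moves [i [lt [_ /ip]]]; lia. Qed.

(** Stated at the turns of P2. The second alternative is final: once P2 owns a copy, she keeps
    it. *)
Lemma following_drawing k :
  drawing (moves p k.*2.+1) (moves p k.*2) \/ copy (moves p k.*2).
Proof.
elim: k => [|k [dr|cp]]; first by left; exact: open_first.
  have := draw_strategy_spec (history p k.*2.+1).
  rewrite -fp /= ?odd_double // historyS rev_rcons /= -historyS.
  rewrite -/(moves p k.*2.+1) -/(moves p k.*2) => [[_ /(_ (moves_legal k) dr)]].
  rewrite /good_move doubleS !movesSS => [[cp|h]]; [by right|left].
  by apply: h; split; rewrite // -?movesSS moves_notin //; lia.
by right; rewrite doubleS movesSS; exact: copy_cons.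
Qed.

Lemma following_no_win : ~ P1_wins 4 p.
Proof.
(* With this [k], the first [2k + 1] moves include all moves of P1 among the first [n], while the
   first [2k] moves are themselves among the first [n]. *)
move=> [n [c1 c2]]; pose k := n.-1./2.
have kn : (n <= k.*2.+2) && (k.*2 <= n) by rewrite /k; lia.
have [dr|cp] := following_drawing k.
  have [nc _] := drawing_step (moves_legal k) dr; apply: nc.
  apply: copy_of_has_copy c1 => e [i [lt [oi <-]]].
  by apply: moves_mem; [move: kn lt oi; lia|rewrite oi /= odd_double].
apply: c2; apply: has_copy_of_copy cp => e /mem_moves [i [lt [oi <-]]].
by exists i; rewrite oi odd_double; split=> //; move: kn lt; lia.
Qed.

End Following.

(* The strong Ramsey game R(K_aleph0^(3), hat K_{2,4}^(3)) is a draw: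
   P2 has a (legal) strategy such that in every legal play following it,
   P1 never wins. *)
Theorem theorem3p1 :
  exists s2 : seq {fset nat} -> {fset nat},
    legal_P2_strategy s2 /\
    forall p : nat -> {fset nat}, play_following s2 p -> ~ P1_wins 4 p.
Proof.
exists draw_strategy; split; first exact: draw_strategy_legal.
by move=> p [bp [ip fp]]; exact: following_no_win.
Qed.
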